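(* Let $n\ge 0$ be an integer, let $X$ be a paracompact space, let $Y$ be a paracompact $C$-space, and let $f\colon X\to Y$ be a $\sigma$-perfect surjection with $\dim f\leq n$. Let $n+1\leq m\leq\omega$ (so $m$ is either an integer $\geq n+1$ or $m=\omega$). Then there exists a dense $G_\delta$-subset $\mathcal{H}_m$ of $C(X,\mathbb{I}^m)$, with respect to the source limitation topology, such that $\dim g(f^{-1}(y))\leq n$ for every $g\in\mathcal{H}_m$ and every $y\in Y$.
   Context: $\mathbb{I}=[0,1]$; $\mathbb{I}^\omega$ is the Hilbert cube (countably infinite product of copies of $\mathbb{I}$); $\dim$ is covering dimension; single-valued maps are continuous; paracompact spaces are Hausdorff. $C(X,Z)$ is the set of all continuous maps from $X$ to $Z$. $\dim f=\sup\{\dim f^{-1}(y): y\in Y\}$. A map is perfect if it is continuous, closed, and has compact fibers. A map $f\colon X\to Y$ is $\sigma$-perfect if there is a sequence $\{X_i\}$ of closed subsets of $X$ with $X=\bigcup_i X_i$ such that each restriction $f|X_i\colon X_i\to f(X_i)$ is perfect and each $f(X_i)$ is closed in $Y$. $Y$ is a $C$-space (has property $C$) if for every sequence $\{\omega_k\}_{k\ge1}$ of open covers of $Y$ there is a sequence $\{\gamma_k\}_{k\ge 1}$ such that each $\gamma_k$ is a family of pairwise disjoint open subsets of $Y$, every member of $\gamma_k$ is contained in some member of $\omega_k$, and $\bigcup_k\gamma_k$ covers $Y$. Source limitation topology on $C(X,Z)$, $(Z,d)$ a metric space: $U\subset C(X,Z)$ is open if for every $g\in U$ there is a continuous $\alpha\colon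 X\to(0,\infty)$ with $\overline{B}(g,\alpha)\subset U$, where $\overline{B}(g,\alpha)=\{h\in C(X,Z): d(g(x),h(x))\leq\alpha(x)\text{ for each }x\in X\}$. For paracompact $X$ this topology does not depend on the choice of the compatible metric $d$ on $Z$; $\mathbb{I}^m$ may be given any compatible metric (Euclidean when $m$ is finite). *)

(* Defs.v *)
From HB Require Import structures.
From mathcomp Require Import all_boot all_order all_algebra.
From mathcomp Require Import all_classical all_reals all_analysis.

Set Implicit Arguments.
Unset Strict Implicit.
Unset Printing Implicit Defensive.

Import Order.TTheory GRing.Theory Num.Theory.
Import numFieldTopology.Exports.

Local Open Scope classical_set_scope.
Local Open Scope card_scope.
Local Open Scope ring_scope.

Section Covers.
Context {T : topologicalType}.
Implicit Types U V : set (set T).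

Definition open_cover U := U `<=` open /\ \bigcup_(A in U) A = [set: T].

Definition refines V U := forall B, V B -> exists2 A, U A & B `<=` A.

Definition locally_finite V := forall x : T,
  exists2 W, nbhs x W & finite_set [set B | V B /\ B `&` W !=set0].

(* No point lies in more than [n + 1] distinct members of [V]. *)
Definition order_le V (n : nat) := forall x : T,
  [set B | V B /\ B x] #<= `I_n.+1.

End Covers.

Definition paracompact (T : topologicalType) :=
  hausdorff_space T /\
  forall U : set (set T), open_cover U ->
    exists V, [/\ open_cover V, refines V U & locally_finite V].

Definition C_space (T : topologicalType) :=
  forall w : nat -> set (set T), (forall k, open_cover (w k)) ->
    exists g : nat -> set (set T),
      (forall k, [/\ g k `<=` open, trivIset (g k) id & refines (g k) (w k)])
      /\ \bigcup_k \bigcup_(A in g k) A = [set: T].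

(* [dim T <= n] for the covering dimension. It is applied to subsets through
   the subspace topology that [set_type] carries; the empty space, of
   dimension -1, satisfies it for every [n : nat]. *)
Definition dim_le (T : topologicalType) (n : nat) :=
  forall U : set (set T), finite_set U -> open_cover U ->
    exists V, [/\ finite_set V, open_cover V, refines V U & order_le V n].

Definition dim_map_le {X Y : topologicalType} (f : X -> Y) (n : nat) :=
  forall y : Y, dim_le (f @^-1` [set y]) n.

Definition perfect_map {X Y : topologicalType} (f : X -> Y) :=
  [/\ continuous f,
      forall A : set X, closed A -> closed (f @` A)
    & forall y : Y, compact (f @^-1` [set y])].

(* [sigLR [fun f in A]] is the corestricted map [A -> f @` A]
   between the subspaces. *)
Definition sigma_perfect {X Y : topologicalType} (f : X -> Y) :=
  exists A : nat -> set X,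
    \bigcup_i A i = [set: X] /\
    forall i, [/\ closed (A i),
                  perfect_map (sigLR [fun f in A i])
                & closed (f @` A i)].

(* [None] stands for omega. *)
Definition leq_omega (k : nat) (m : option nat) : bool :=
  if m is Some m' then (k <= m')%N else true.

Definition cube_index (m : option nat) : Type :=
  if m is Some m' then 'I_m' else nat.

Definition unit_interval (R : realType) : set R := `[0, 1].
Arguments unit_interval : clear implicits.

Definition cube (R : realType) (m : option nat) : topologicalType :=
  prod_topology (fun _ : cube_index m => unit_interval R).

Record compatible_metric {R : realType} {Z : topologicalType}
    (d : Z -> Z -> R) : Prop := CompatibleMetric {
  cmetric_ge0 : forall x y, 0 <= d x y;
  cmetric_eq0 : forall x y, d x y = 0 <-> x = y;
  cmetric_sym : forall x y, d x y = d y x;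
  cmetric_triangle : forall x y z, d x z <= d x y + d y z;
  cmetric_nbhs : forall x (A : set Z),
    nbhs x A <-> exists2 e : R, 0 < e & [set y | d x y < e] `<=` A
}.

(* [C(X, Z)], as an alias indexed by the metric [d] so that it can carry the
   source limitation topology. *)
Definition source_limitation {R : realType} (X : topologicalType)
  {Z : topologicalType} (d : Z -> Z -> R) : Type := continuousType X Z.

Section SourceLimitation.
Context {R : realType} {X Z : topologicalType} (d : Z -> Z -> R).

Definition sl_ball (g : continuousType X Z) (a : X -> R) :
    set (continuousType X Z) :=
  [set h | forall x, d (g x) (h x) <= a x].

Definition sl_open (U : set (continuousType X Z)) :=
  forall g, U g -> exists a : X -> R,
    [/\ continuous a, forall x, 0 < a x & sl_ball g a `<=` U].

Lemma sl_openT : sl_open setT.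
Proof.
by move=> g _; exists (fun=> 1); split => // x; exact: cvg_cst.
Qed.

Lemma sl_openI : setI_closed sl_open.
Proof.
move=> U V oU oV g [/oU [a [ca a0 aU]] /oV [b [cb b0 bV]]].
exists (a \min b); split.
- by move=> x; apply: continuous_min; [exact: ca|exact: cb].
- by move=> x /=; rewrite lt_min a0 b0.
- move=> h gh; split.
  + by apply: aU => x; apply: (le_trans (gh x)); rewrite ge_min lexx.
  + by apply: bV => x; apply: (le_trans (gh x)); rewrite ge_min lexx orbT.
Qed.

Lemma sl_open_bigU (I : Type) (F : I -> set (continuousType X Z)) :
  (forall i, sl_open (F i)) -> sl_open (\bigcup_i F i).
Proof.
move=> oF g [i _ /oF [a [ca a0 aF]]]; exists a; split => // h /aF Fh.
by exists i.
Qed.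

HB.instance Definition _ := Choice.copy (source_limitation X d)
  (continuousType X Z).
HB.instance Definition _ := isOpenTopological.Build (source_limitation X d)
  sl_openT sl_openI sl_open_bigU.

Lemma source_limitation_openE :
  open = (sl_open : set (set (source_limitation X d))).
Proof. by []. Qed.

End SourceLimitation.

(* Main.v *)
Require Import Defs.
From HB Require Import structures.
From mathcomp Require Import all_boot all_order all_algebra.
From mathcomp Require Import all_classical all_reals all_analysis.
From mathcomp Require Import borel_hierarchy.
From mathcomp Require Import ring lra finmap zify.

Set Implicit Arguments.
Unset Strict Implicit.
Unset Printing Implicit Defensive.

Import Order.TTheory GRing.Theory Num.Theory.
Import numFieldTopology.Exports numFieldNormedType.Exports.

Local Open Scope classical_set_scope.
Local Open Scope ring_scope.

(** Fix the closed sets [A i], covering [X], on which [f] is perfect.  The fibre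
    over [y] is the union of the compact sets [A i `&` f^-1 y], so its image
    under a map [g] is a countable union of compacta.  Such a union has dimension
    at most [n] as soon as each of the compacta has, at every scale [j], a cover
    by [n + 1] disjoint families of small open sets ([small_cover]); this follows
    from the existence of Lebesgue numbers and the countable sum theorem
    ([small_cover_sigma_dim]).  The source limitation topology has the Baire
    property ([source_limitation_baire]), so it remains to see that, for fixed
    [i] and [j], the maps [g] for which all the sets [g (A i `&` f^-1 y)] have
    such covers form a dense open set.  Openness ([fiberwise_small_open]) is a
    compactness argument along the fibres, made uniform by paracompactness of
    [Y].

    Density ([fiberwise_small_approx]) is the core.  Let [g0] be given.  Near one
    fibre, a cover of order at most [n] has a partition of unity, which combined
    with a choice of points of the cube close to the values of [g0] gives a map
    that sends the fibres in [A i] into finitely many [n]-simplices: a chart.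
    Taking arbitrary convex combinations of such maps over [Y] would destroy
    this property.  Instead, levels of charts are constructed such that a chart
    refines every chart of an earlier level that it meets ([refining_levels]),
    property C selects from each level [k] a disjoint family, and bump functions
    [phi k] subordinate to the selected charts are chosen such that at each [y]
    one of them is 1 ([blend_data]).  The image of [x] is the expected final
    position of a random walk through the levels, from the high ones down to 0.
    At level [k] the walk moves with probability [phi k (f x)], namely to a vertex
    of the active chart: at its first move to a vertex chosen with the
    barycentric coordinates of [x] as probabilities, later to a vertex whose star
    contains the star of the present one.  This expectation is continuous in
    [x], although the active charts and the vertices chosen are not, because
    these only jump where the corresponding probability is 0.  If [phi t y = 1],
    every walk for a point [x] over [y] goes through a vertex of the chart of
    level [t], and after that its law depends only on this vertex and on [y].
    Hence the image of [x] lies in the simplex spanned by the expected positions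
    from the at most [n + 1] vertices of that chart whose star contains [x]
    ([blend_simplex]): once more the fibre goes into finitely many
    [n]-simplices.

    Finally, a finite union of [n]-simplices has small covers of the required
    kind ([simplices_small_cover]).  For each of [n + 1] colours the cube is cut
    into cells by coordinate hyperplanes, and if the positions of these are
    generic, no point of an [n]-simplex lies on cuts of all the colours. *)

(** * Continuous functions and compactness *)

Lemma finite_set_bounded (T : eqType) (A : set T) (f : T -> nat) :
  finite_set A -> exists M, forall a, A a -> (f a < M)%N.
Proof.
move=> /finite_seqP[s ->]; exists (\max_(a <- s) f a).+1 => a /= sa.
by rewrite ltnS; exact: leq_bigmax_seq.
Qed.

Lemma compact_finite_subcover (T : topologicalType) (I : eqType) (K : set T)
    (f : I -> set T) : compact K -> (forall i, open (f i)) ->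
  K `<=` \bigcup_i f i ->
  exists s : seq I, forall x, K x -> exists2 i, i \in s & f i x.
Proof.
move=> /compact_near_coveringP cK of_ Kf.
(* The filter of all sufficiently large finite sets of indices. *)
pose F : set_system (seq I) :=
  [set P | exists s0 : seq I, forall s : seq I, {subset s0 <= s} -> P s].
have FF : Filter F.
  split=> [|P Q [s0 s0P] [s1 s1Q]|P Q PQ [s0 s0P]].
  - by exists [::].
  - exists (s0 ++ s1) => s ss; split; [apply: s0P|apply: s1Q] => i si;
      by apply: ss; rewrite mem_cat si ?orbT.
  - by exists s0 => s /s0P/PQ.
have [|s sK] := cK _ F (fun s x => exists2 i, i \in s & f i x) FF.
  move=> x /Kf[i _ fix_].
  exists (f i, [set s : seq I | i \in s]) => /=.
    split; first exact: open_nbhs_nbhs.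
    by exists [:: i] => s; apply; rewrite mem_head.
  by move=> [x' s] [/= fix' si]; exists i.
by exists s => x Kx; apply: sK Kx.
Qed.

Lemma near_eq_continuous_at (T U : topologicalType) (t : T) (h h' : T -> U) :
  (\forall z \near t, h' z = h z) -> continuous_at t h' -> continuous_at t h.
Proof.
move=> hh' ch'; rewrite /continuous_at -(nbhs_singleton hh').
apply: cvg_trans ch'; apply: near_eq_cvg.
by apply: filterS hh' => z ->.
Qed.

Lemma continuous_sum (R : realType) (T : topologicalType) (I : Type)
    (s : seq I) (f : I -> T -> R) :
  (forall i, continuous (f i)) -> continuous (fun x => \sum_(i <- s) f i x).
Proof.
move=> cf x; elim: s => [|i s IHs].
  rewrite [X in continuous_at _ X](_ : _ = fun=> 0); first exact: cvg_cst.
  by apply/funext => z; rewrite big_nil.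
rewrite [X in continuous_at _ X](_ : _ = fun z => f i z + \sum_(i <- s) f i z).
  by apply: cvgD; [exact: cf|exact: IHs].
by apply/funext => z; rewrite big_cons.
Qed.

Lemma continuous_posB (R : realType) (T : topologicalType) (f g : T -> R) :
  continuous f -> continuous g ->
  continuous (fun x => Num.max (f x - g x) 0).
Proof.
move=> cf cg x; apply: (@continuous_max _ _ (fun x => f x - g x) (fun=> 0)).
  by apply: cvgB; [exact: cf|exact: cg].
exact: cst_continuous.
Qed.

Lemma continuous_bigmin (R : realType) (T : topologicalType) (I : Type)
    (s : seq I) (P : pred I) (x0 : T -> R) (f : I -> T -> R) :
  continuous x0 -> (forall i, continuous (f i)) ->
  continuous (fun x => \big[Num.min/x0 x]_(i <- s | P i) f i x).
Proof.
move=> c0 cf; elim: s => [|i s IHs].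
  rewrite (_ : (fun x => _) = x0)//.
  by apply/funext => x; rewrite big_nil.
case: (boolP (P i)) => Pi.
  rewrite (_ : (fun x => _) = (fun x =>
    Num.min (f i x) (\big[Num.min/x0 x]_(i <- s | P i) f i x))).
    by move=> x; apply: continuous_min; [exact: cf|exact: IHs].
  by apply/funext => x; rewrite big_cons Pi.
rewrite (_ : (fun x => _) = (fun x => \big[Num.min/x0 x]_(i <- s | P i) f i x))//.
by apply/funext => x; rewrite big_cons (negPf Pi).
Qed.

(** At a zero of [phi] the boundedness of [h] alone makes the product
    continuous.  This allows [h] to be defined by arbitrary choices wherever
    [phi] vanishes, as happens throughout the blending of charts. *)
Lemma bump_mul_continuous (R : realType) (T : topologicalType) (phi h : T -> R) :
  continuous phi -> (forall t, `|h t| <= 1) ->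
  (forall t, phi t != 0 -> continuous_at t h) ->
  continuous (fun t => phi t * h t).
Proof.
move=> cphi h1 ch t; have [phit|phit] := eqVneq (phi t) 0; last first.
  by apply: cvgM; [exact: cphi|exact: ch].
rewrite /continuous_at phit mul0r; apply/cvgrPdist_lt => e e0.
have := @cphi t => /cvgrPdist_lt/(_ e e0).
apply: filterS => t'; rewrite phit !sub0r !normrN normrM.
by apply: le_lt_trans; rewrite ler_piMr.
Qed.

Lemma open_lt_fun (R : realType) (T : topologicalType) (f g : T -> R) :
  continuous f -> continuous g -> open [set x | f x < g x].
Proof.
move=> cf cg.
rewrite [X in open X](_ : _ = (g \- f) @^-1` [set y | 0 < y]).
  apply: open_comp; last exact: open_gt.
  by move=> x _; apply: cvgB; [exact: cg|exact: cf].
by apply/seteqP; split => x /=; rewrite subr_gt0.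
Qed.

Lemma closed_le_fun (R : realType) (T : topologicalType) (f g : T -> R) :
  continuous f -> continuous g -> closed [set x | f x <= g x].
Proof.
move=> cf cg.
rewrite [X in closed X](_ : _ = ~` [set x | g x < f x]).
  exact/open_closedC/open_lt_fun.
by apply/seteqP; split => x /=; rewrite leNgt => /negP.
Qed.

Lemma exp2V_lt (R : realType) (e : R) : 0 < e -> \forall j \near \oo, 2^-1 ^+ j < e.
Proof.
move=> e0; have := @cvg_expr R 2^-1.
have -> : `|2^-1| < 1 :> R by rewrite gtr0_norm//; lra.
move=> /(_ isT)/cvgrPdist_lt/(_ e e0); apply: filterS => j.
by rewrite sub0r normrN gtr0_norm ?exprn_gt0.
Qed.

(** * Separation and bump functions on paracompact spaces *)

(** Only finitely many members matter near [x], and a finite union of closures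
    is closed. *)
Lemma locally_finite_closure (T : topologicalType) (V : set (set T)) (x : T) :
  locally_finite V -> closure (\bigcup_(B in V) B) x ->
  exists2 B, V B & closure B x.
Proof.
move=> /(_ x)[W nW fW] clx.
have := closed_bigcup fW (fun B _ => @closed_closure _ B).
set F := \bigcup_(i in _) _ => cF.
apply: contrapT => nB.
have nFx : ~ F x.
  by move=> [B [VB _] clB]; apply: nB; exists B.
have : nbhs x (W `&` ~` F).
  apply: filterI => //; apply: open_nbhs_nbhs; split => //.
  exact: closed_openC.
move=> /clx[z [[B VB Bz] [Wz]]]; apply; exists B; last exact: subset_closure.
by split => //; exists z.
Qed.

(** The neighbourhoods [N] together with the complement of [C] form an open
    cover.  In a locally finite refinement of it, the members that meet [C] lie
    in sets [N], and local finiteness keeps the closure of their union away from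
    [D].  With [D] a point this gives regularity, and with [D] a closed set it
    then gives normality. *)
Lemma paracompact_separation (T : topologicalType) (C D : set T) :
  paracompact T -> closed C ->
  (forall c, C c -> exists N, [/\ open N, N c & closure N `&` D = set0]) ->
  exists O, [/\ open O, C `<=` O & closure O `&` D = set0].
Proof.
move=> [_ pT] cC sep.
pose U : set (set T) := [set N | open N /\ (closure N `&` D = set0 \/ N = ~` C)].
have [|V [[oV cV] rV lfV]] := pT U.
  split; first by move=> N [].
  rewrite -subTset => x _; have [Cx|nCx] := pselect (C x).
    by have [N [oN Nx ND]] := sep _ Cx; exists N => //; split => //; left.
  by exists (~` C) => //; split; [exact: closed_openC|right].
pose V' := [set B | V B /\ B `&` C !=set0].
have lfV' : locally_finite V'.
  move=> x; have [W nW fW] := lfV x; exists W => //.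
  by apply: sub_finite_set fW => B [[]].
exists (\bigcup_(B in V') B); split.
- by apply: bigcup_open => B [/oV].
- move=> x Cx; have : (\bigcup_(A in V) A) x by rewrite cV.
  by move=> [B VB Bx]; exists B => //; split => //; exists x.
- rewrite -subset0 => x [/(locally_finite_closure lfV')[B [VB [z [Bz Cz]]] clB] Dx].
  have [N [_ [ND|NC]] BN] := rV _ VB.
    by suff: set0 x by []; rewrite -ND; split => //; exact: (closureS BN).
  by have := BN _ Bz; rewrite NC; apply.
Qed.

Lemma paracompact_regular (T : topologicalType) (x : T) (U : set T) :
  paracompact T -> open U -> U x ->
  exists V, [/\ open V, V x & closure V `<=` U].
Proof.
move=> pT oU Ux.
have [||O [oO UO Ox]] := @paracompact_separation _ (~` U) [set x] pT.
- exact: open_closedC.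
- move=> c nUc; have : c != x by apply: contra_notN nUc => /eqP ->.
  move: pT => [+ _]; rewrite open_hausdorff => /[apply] -[[A B]/= [Ac Bx] [oA oB AB]].
  move: Ac Bx => /set_mem Ac /set_mem Bx.
  exists A; split => //; rewrite -subset0 => z [clA zx].
  rewrite zx in clA.
  have [w wAB] := clA B (open_nbhs_nbhs (conj oB Bx)).
  by move: wAB; rewrite (eqP AB).
exists (~` closure O); split.
- exact/closed_openC/closed_closure.
- by move=> clO; suff: set0 x by []; rewrite -Ox; split.
- have cO : closed (~` O) by exact: open_closedC.
  have : closure (~` closure O) `<=` closure (~` O).
    by apply/closureS/subsetC; exact: subset_closure.
  move=> /subset_trans; apply; rewrite -(proj1 (closure_id _) cO) => z nOz.
  by apply: contrapT => nUz; apply: nOz; exact: UO.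
Qed.

Lemma paracompact_normal (R : realType) (T : topologicalType) :
  paracompact T -> normal_space T.
Proof.
move=> pT; apply/(@normal_openP R) => A B cA cB AB0.
have [|O [oO AO OB]] := @paracompact_separation _ A B pT cA.
  move=> c Ac; have [||V [oV Vc VB]] := @paracompact_regular _ c (~` B) pT.
  - exact: closed_openC.
  - by move=> Bc; suff: set0 c by []; rewrite -AB0.
  - by exists V; split => //; apply/disjoints_subset.
exists O, (~` closure O); split => //.
- exact/closed_openC/closed_closure.
- by move=> z Bz clz; suff: set0 z by []; rewrite -OB; split.
- by rewrite -subset0 => z [Oz]; apply; exact: subset_closure.
Qed.

Lemma normal_urysohn (R : realType) (T : topologicalType) (A B : set T) :
  normal_space T -> closed A -> closed B -> A `&` B = set0 ->
  exists f : T -> R, [/\ continuous f, forall x, 0 <= f x <= 1,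
    forall x, A x -> f x = 0 & forall x, B x -> f x = 1].
Proof.
move=> /(@normal_separatorP R) nT cA cB /(nT _ _ cA cB).
move=> /(@uniform_separatorP _ R)[f [cf f01 fA fB]]; exists f; split => //.
- by move=> x; have /= := f01 (f x) (ex_intro2 _ _ x I erefl); rewrite in_itv.
- by move=> x Ax; apply: (fA (f x)); exists x.
- by move=> x Bx; apply: (fB (f x)); exists x.
Qed.

Lemma paracompact_point_urysohn (R : realType) (T : topologicalType) (x : T)
    (U : set T) : paracompact T -> open U -> U x ->
  exists f : T -> R, [/\ continuous f, forall z, 0 <= f z <= 1, f x = 1
    & forall z, 0 < f z -> U z].
Proof.
move=> pT oU Ux.
have nT := paracompact_normal R pT.
have [|||f [cf f01 f0 f1]] := @normal_urysohn R T (~` U) [set x] nT.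
- exact: open_closedC.
- by apply: accessible_closed_set1; apply: hausdorff_accessible; case: pT.
- by rewrite -subset0 => z [nUz zx]; apply: nUz; rewrite zx.
- exists f; split => //; first exact: f1.
  by move=> z; apply: contraPP => nUz; rewrite f0// ltxx.
Qed.

(** A locally finite refinement of the cover, grouped by an index of a set
    [W k] that contains each member.  Local finiteness becomes the vanishing
    of the tail of the sequence near each point. *)
Lemma paracompact_lf_cover (T : topologicalType) (W : nat -> set T) :
  paracompact T -> (forall k, open (W k)) -> \bigcup_k W k = setT ->
  exists W' : nat -> set T, [/\ forall k, open (W' k),
    forall k, W' k `<=` W k, \bigcup_k W' k = setT &
    forall x : T, exists M, \forall z \near x, forall k, (M <= k)%N -> ~ W' k z].
Proof.
move=> [_ pT] oW cW.
have [|V [[oV cV] rV lfV]] := pT (range W).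
  split; first by move=> _ [k _ <-].
  by rewrite bigcup_image.
have idxP B : exists k, V B -> B `<=` W k.
  have [VB|nVB] := pselect (V B); last by exists 0%N.
  by have [_ [k _ <-] BW] := rV _ VB; exists k.
have [idx idxV] := choice idxP.
exists (fun k => \bigcup_(B in [set B | V B /\ idx B = k]) B); split.
- by move=> k; apply: bigcup_open => B [/oV].
- by move=> k x [B [VB <-]]; exact: idxV.
- rewrite -subTset => x _; have : (\bigcup_(A in V) A) x by rewrite cV.
  by move=> [B VB Bx]; exists (idx B) => //; exists B.
- move=> x; have [N nN fN] := lfV x.
  have [M idxM] := finite_set_bounded idx fN.
  exists M; near=> z => k Mk [B [VB Bk] Bz].
  suff : (k < M)%N by rewrite ltnNge Mk.
  by rewrite -Bk; apply: idxM; split => //; exists z; split => //; near: z.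
Unshelve. all: by end_near. Qed.

(** Here the refined cover consists of the open sets whose closure lies in some
    [W k], so that the grouped closures are still inside the [W k]. *)
Lemma paracompact_lf_shrink (T : topologicalType) (W : nat -> set T) :
  paracompact T -> (forall k, open (W k)) -> \bigcup_k W k = setT ->
  exists F : nat -> set T, [/\ forall k, closed (F k),
    forall k, F k `<=` W k & \bigcup_k F k = setT].
Proof.
move=> pT oW cW; have [_ pT'] := pT.
have [|V [[oV cV] rV lfV]] :=
    pT' [set N | open N /\ exists k, closure N `<=` W k].
  split; first by move=> N [].
  rewrite -subTset => x _; have : (\bigcup_k W k) x by rewrite cW.
  move=> [k _ Wx]; have [N [oN Nx NW]] := paracompact_regular pT (oW k) Wx.
  by exists N => //; split => //; exists k.
have idxP B : exists k, V B -> closure B `<=` W k.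
  have [VB|nVB] := pselect (V B); last by exists 0%N.
  have [N [_ [k NW]] BN] := rV _ VB; exists k => _.
  exact: subset_trans (closureS BN) NW.
have [idx idxV] := choice idxP.
pose V' k := [set B | V B /\ idx B = k].
have lfV' k : locally_finite (V' k).
  move=> x; have [N nN fN] := lfV x; exists N => //.
  by apply: sub_finite_set fN => B [[]].
exists (fun k => closure (\bigcup_(B in V' k) B)); split.
- by move=> k; exact: closed_closure.
- move=> k x /(locally_finite_closure (lfV' k))[B [VB <-]]; exact: idxV.
- rewrite -subTset => x _; have : (\bigcup_(A in V) A) x by rewrite cV.
  move=> [B VB Bx]; exists (idx B) => //; apply: subset_closure.
  by exists B.
Qed.

(** A partition of unity without the normalization: what the blending needs is
    that some bump reaches the value 1 at each point. *)
Lemma paracompact_bumps (R : realType) (T : topologicalType)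
    (W : nat -> set T) :
  paracompact T -> (forall k, open (W k)) -> \bigcup_k W k = setT ->
  exists phi : nat -> T -> R, [/\ forall k, continuous (phi k),
    forall k x, 0 <= phi k x <= 1, forall k x, 0 < phi k x -> W k x,
    forall x, exists k, phi k x = 1 &
    forall x : T, exists M, \forall z \near x, forall k, (M <= k)%N -> phi k z = 0].
Proof.
move=> pT oW cW.
have [W' [oW' W'W cW' lfW']] := paracompact_lf_cover pT oW cW.
have [F [cF FW cvF]] := paracompact_lf_shrink pT oW' cW'.
have nT := paracompact_normal R pT.
have phiP k : exists f : T -> R, [/\ continuous f, forall x, 0 <= f x <= 1,
    forall x, ~ W' k x -> f x = 0 & forall x, F k x -> f x = 1].
  apply: normal_urysohn => //; first exact: open_closedC.
  by rewrite -subset0 => x [nW /FW].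
have [phi phiH] := choice phiP.
exists phi; split.
- by move=> k; have [] := phiH k.
- by move=> k; have [] := phiH k.
- move=> k x; have [_ _ phi0 _] := phiH k.
  by apply: contraPP => nWx; rewrite phi0 ?ltxx// => /W'W.
- move=> x; have : (\bigcup_k F k) x by rewrite cvF.
  by move=> [k _ Fx]; exists k; have [_ _ _] := phiH k; apply.
- move=> x; have [M nM] := lfW' x; exists M.
  apply: filterS nM => z W'z k Mk; have [_ _ phi0 _] := phiH k.
  exact/phi0/W'z.
Qed.

(** * The countable sum theorem in metrizable spaces *)

Lemma card_le_finpred (I : finType) (P : set I) (N : nat) :
  (P #<= `I_N)%card = (#|[pred i | `[< P i >]]| <= N)%N.
Proof.
set A := [pred i | _].
have -> : P = [set` [fset i in enum A]%fset].
  apply/seteqP; split => i /=; rewrite !inE mem_enum inE /=.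
  - by move=> Pi; apply/asboolP.
  - by move/asboolP.
have /card_eq_fsetP e : #|` [fset i in enum A]%fset| = #|A|.
  by rewrite card_fseq undup_id ?enum_uniq// cardE.
by rewrite (card_le_eql e) card_le_II.
Qed.

Section Metric.
Context {R : realType} {T : topologicalType} {d : T -> T -> R}.
Hypothesis hd : compatible_metric d.

Lemma cmetric_xx (x : T) : d x x = 0.
Proof. exact/(cmetric_eq0 hd). Qed.

Lemma cmetric_near (x : T) (e : R) : 0 < e -> \forall z \near x, d x z < e.
Proof. by move=> e0; apply/(cmetric_nbhs hd); exists e. Qed.

Lemma cmetric_lipschitz_continuous (u : T -> R) :
  (forall x z, u x <= u z + d x z) -> continuous u.
Proof.
move=> lip x; apply/cvgrPdist_lt => e e0; near=> z.
have dxz : d x z < e by near: z; exact: cmetric_near.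
have := lip x z; have := lip z x; rewrite (cmetric_sym hd z).
by move=> *; rewrite ltr_norml; lra.
Unshelve. all: by end_near. Qed.

Lemma cmetric_zero_set (F : set T) : closed F ->
  exists u : T -> R, [/\ continuous u, forall z, 0 <= u z
    & forall z, u z = 0 <-> F z].
Proof.
move=> cF; pose D z := [set d z w | w in F] `|` [set 1].
have D0 z r : D z r -> 0 <= r.
  by move=> [[w _ <-]|->]; [exact: cmetric_ge0 hd _ _|].
have lbD z : has_lbound (D z) by exists 0 => r; exact: D0.
have neD z : D z !=set0 by exists 1; right.
have u0 z : 0 <= inf (D z) by apply: lb_le_inf => // r; exact: D0.
exists (fun z => inf (D z)); split => //.
  apply: cmetric_lipschitz_continuous => x z.
  rewrite -lerBlDr; apply: lb_le_inf => // r [[w Fw <-]|->].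
    rewrite lerBlDr; apply: le_trans (_ : d x w <= _).
      by apply: ge_inf => //; left; exists w.
    by rewrite addrC; exact: cmetric_triangle.
  rewrite lerBlDr; apply: le_trans (_ : 1 <= _); first by apply: ge_inf => //; right.
  by rewrite lerDl; exact: cmetric_ge0 hd _ _.
move=> z; split => [Dz|Fz]; last first.
  apply/eqP; rewrite eq_le u0 andbT; apply: ge_inf => //.
  by left; exists z => //; exact: cmetric_xx.
rewrite (proj1 (closure_id F) cF) => B /(cmetric_nbhs hd)[e e0 eB].
have [r Dr] : exists2 r, D z r & r < Num.min 1 e.
  have m0 : 0 < Num.min 1 e by rewrite lt_min ltr01 e0.
  have [r Dr] := @inf_adherent R (D z) _ m0 (conj (neD z) (lbD z)).
  by rewrite Dz add0r => rm; exists r.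
rewrite lt_min => /andP[r1 re].
case: Dr => [[w Fw wr]|r1']; last by rewrite r1' ltxx in r1.
by exists w; split => //; apply: eB => /=; rewrite wr.
Qed.

(** Let [u i] be the distance to the complement of [U i], and [h] the sum of all
    [u i] divided by [k + 1].  As [h] is positive and less than the average, some
    [u i] exceeds it at every point, and the set where [u i] is at least [h] is a
    closed subset of [U i]. *)
Lemma metric_shrink (k : nat) (U : 'I_k -> set T) :
  (forall i, open (U i)) -> \bigcup_i U i = setT ->
  exists V K : 'I_k -> set T, [/\ forall i, open (V i), forall i, closed (K i),
    forall i, V i `<=` K i, forall i, K i `<=` U i & \bigcup_i V i = setT].
Proof.
move=> oU cU.
have uP i : exists u : T -> R, [/\ continuous u, forall z, 0 <= u z
    & forall z, u z = 0 <-> (~` U i) z].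
  by apply: cmetric_zero_set; exact: open_closedC.
have [u uH] := choice uP.
have cu i : continuous (u i) by have [] := uH i.
have u0 i z : 0 <= u i z by have [_ + _] := uH i; exact.
have uU i z : 0 < u i z -> U i z.
  move=> uiz; apply: contrapT => nU; have [_ _ ui] := uH i.
  by move: uiz; rewrite (proj2 (ui z) nU) ltxx.
pose S z := \sum_(i <- enum 'I_k) u i z.
pose h z := S z / k.+1%:R.
have ch : continuous h.
  by move=> z; apply: cvgMl; apply: continuous_sum.
have S0 z : 0 < S z.
  have : (\bigcup_i U i) z by rewrite cU.
  move=> [i _ Uiz].
  have : 0 < u i z.
    rewrite lt_neqAle u0 andbT eq_sym; apply/eqP => uiz.
    by have [_ _ ui] := uH i; exact: (proj1 (ui z) uiz).
  move=> /lt_le_trans; apply; rewrite /S.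
  by rewrite (bigD1_seq i) ?enum_uniq ?mem_enum//= lerDl; exact: sumr_ge0.
have h0 z : 0 < h z by rewrite divr_gt0.
exists (fun i => [set z | h z < u i z]), (fun i => [set z | h z <= u i z]).
split.
- by move=> i; exact: open_lt_fun.
- by move=> i; exact: closed_le_fun.
- by move=> i z; exact: ltW.
- by move=> i z /= hu; apply: uU; exact: lt_le_trans hu.
- rewrite -subTset => z _; apply: contrapT => nz.
  have : S z <= \sum_(i <- enum 'I_k) h z.
    apply: ler_sum => i _; rewrite leNgt; apply/negP => hi; apply: nz.
    by exists i.
  rewrite big_const_seq count_predT size_enum_ord iter_addr_0 /h.
  rewrite leNgt => /negP; apply.
  by rewrite -[_ *+ k]mulr_natr mulrAC ltr_pdivrMr// ltr_pM2l// ltr_nat.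
Qed.

(** With [u i] the distance to [F i], the open set [G i] consists of the points
    of [U i] at which at most [n] of the numbers [u j] are at most [u i].  On
    [F i] these are the [j] with [u j = 0].  If a point lies in several [G i],
    the one among them with the largest [u i] counts all of them. *)
Lemma metric_swell (k n : nat) (F U : 'I_k -> set T) :
  (forall i, closed (F i)) -> (forall i, open (U i)) ->
  (forall i, F i `<=` U i) ->
  (forall z, #|[pred i | `[< F i z >]]| <= n)%N ->
  exists G : 'I_k -> set T, [/\ forall i, open (G i), forall i, F i `<=` G i,
    forall i, G i `<=` U i & forall z, (#|[pred i | `[< G i z >]]| <= n)%N].
Proof.
move=> cF oU FU ordF.
have [u uH] := choice (fun i => cmetric_zero_set (cF i)).
have cu i : continuous (u i) by have [] := uH i.
have u0 i z : 0 <= u i z by have [_ + _] := uH i; exact.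
pose below i z := [pred j | u j z <= u i z].
pose G i := U i `&` [set z | (#|below i z| <= n)%N].
exists G; split.
- move=> i; apply: openI => //; rewrite openE => z /= zn.
  have : \forall z' \near z, forall j, u i z < u j z -> u i z' < u j z'.
    apply: filter_forall => j; have [ij|_] := ltP (u i z) (u j z); last exact: nearW.
    apply: filterS (_ : nbhs z [set z' | u i z' < u j z']) => //.
    by apply: open_nbhs_nbhs; split => //; exact: open_lt_fun.
  apply: filterS => z' zz'; apply: leq_trans zn.
  apply: subset_leq_card; apply/fintype.subsetP => j; rewrite !inE !leNgt.
  by apply: contra => /zz'.
- move=> i z Fz; split; first exact: FU.
  apply: leq_trans (ordF z); apply: subset_leq_card; apply/fintype.subsetP => j.
  have [_ _ ui] := uH i; have [_ _ uj] := uH j.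
  rewrite !inE (proj2 (ui z) Fz) => uj0; apply/asboolP/uj.
  by apply/eqP; rewrite eq_le uj0 u0.
- by move=> i z [].
- move=> z; have [i0|/eq_card0 ->//] := pickP [pred i | `[< G i z >]].
  move=> Gi0; case: (@arg_maxP _ _ _ i0 [pred i | `[< G i z >]] (u^~ z) Gi0) => i.
  rewrite inE => /asboolP[_ iz] imax; apply: leq_trans iz.
  by apply: subset_leq_card; apply/fintype.subsetP => j /imax.
Qed.

(** Relative version of [dim_le]: covers and refinements are open in the whole
    space and share their index set, and the order is only controlled on
    [C]. *)
Definition rel_dim_le (n : nat) (C : set T) :=
  forall k (U : 'I_k -> set T), (forall i, open (U i)) -> C `<=` \bigcup_i U i ->
  exists W : 'I_k -> set T, [/\ forall i, open (W i), forall i, W i `<=` U i,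
    C `<=` \bigcup_i W i
  & forall z, C z -> (#|[pred i | `[< W i z >]]| <= n.+1)%N].

(** Starting from a finite open cover, shrink it once for each [C j]: first
    replace its trace on [C j] by a trace of order at most [n], then shrink to
    closed sets [K j i].  The intersections of the [K j i] over [j] still cover,
    because there are finitely many indices [i], and they have order at most [n]
    at every point.  Swelling them gives the refinement. *)
Lemma metric_countable_sum (n : nat) (C : nat -> set T) :
  (forall j, closed (C j)) -> \bigcup_j C j = setT ->
  (forall j, rel_dim_le n (C j)) -> dim_le T n.
Proof.
move=> cC CT dC U0 /finite_seqP[s U0s] [oU0 cU0].
pose k := size s; pose U (i : 'I_k) : set T := nth set0 s i.
have U0U i : U0 (U i) by rewrite U0s /=; exact: mem_nth.
have oU i : open (U i) by exact: oU0.
have cU : \bigcup_i U i = setT.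
  rewrite -subTset => z _; have : (\bigcup_(A in U0) A) z by rewrite cU0.
  move=> [A]; rewrite U0s /= => As Az.
  have ki : (index A s < k)%N by rewrite index_mem.
  by exists (Ordinal ki) => //; rewrite /U /= nth_index.
pose cover (V : 'I_k -> set T) := (forall i, open (V i)) /\ \bigcup_i V i = setT.
have stepP (jV : nat * ('I_k -> set T)) :
    exists WK : ('I_k -> set T) * ('I_k -> set T), cover jV.2 ->
    [/\ cover WK.1, forall i, closed (WK.2 i), forall i, WK.1 i `<=` WK.2 i,
      forall i, WK.2 i `<=` jV.2 i &
      forall z, C jV.1 z -> (#|[pred i | `[< WK.2 i z >]]| <= n.+1)%N].
  case: jV => j V /=.
  have [[oV cV]|ncV] := pselect (cover V); last by exists (V, V).
  have [|W [oW WV CW ordW]] := dC j k V oV; first by rewrite cV.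
  (* Nothing changes off [C j], while the order becomes small on it. *)
  pose V' i := (V i `\` C j) `|` W i.
  have [||V1 [K [oV1 cK V1K KV' cV1]]] := @metric_shrink k V'.
  - by move=> i; apply: openU => //; apply: openI => //; exact: closed_openC.
  - rewrite -subTset => z _; have [Cz|nCz] := pselect (C j z).
      by have [i _ Wiz] := CW _ Cz; exists i => //; right.
    have : (\bigcup_i V i) z by rewrite cV.
    by move=> [i _ Viz]; exists i => //; left.
  - exists (V1, K) => _; split => //= [i z /KV'|z Cz].
      by move=> [[]//|]; exact: WV.
    apply: leq_trans (ordW z Cz); apply: subset_leq_card; apply/fintype.subsetP => i.
    by rewrite !inE => /asboolP/KV'[[]//|Wz]; exact/asboolP.
have [step stepH] := choice stepP.
pose V := fix V j : 'I_k -> set T := if j is j'.+1 then (step (j', V j')).1 else U.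
pose K j := (step (j, V j)).2.
have covV j : cover (V j).
  by elim: j => [//|j IH]; have [] := stepH (j, V j) IH.
have cK j i : closed (K j i).
  by have [_ + _ _ _] := stepH (j, V j) (covV j); exact.
have VK j i : V j.+1 i `<=` K j i.
  by have [_ _ + _ _] := stepH (j, V j) (covV j); exact.
have KV j i : K j i `<=` V j i.
  by have [_ _ _ + _] := stepH (j, V j) (covV j); exact.
have ordK j z : C j z -> (#|[pred i | `[< K j i z >]]| <= n.+1)%N.
  by have [_ _ _ _] := stepH (j, V j) (covV j); exact.
pose F i := \bigcap_j K j i.
have Vdecr i j j' z : (j <= j')%N -> V j' i z -> V j i z.
  move=> /subnK <-; elim: (j' - j)%N => [//|m IH].
  by rewrite addSn => /VK/KV.
have [|//|||G [oG FG GU ordG]] := @metric_swell k n.+1 F U.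
- by move=> i; apply: closed_bigI => j _; exact: cK.
- by move=> i z /(_ 0%N I)/KV.
- move=> z; have : (\bigcup_j C j) z by rewrite CT.
  move=> [j _ Cz]; apply: leq_trans (ordK j z Cz).
  apply: subset_leq_card; apply/fintype.subsetP => i.
  by rewrite !inE => /asboolP/(_ j I) Kz; exact/asboolP.
have cG : \bigcup_i G i = setT.
  rewrite -subTset => z _; apply: contrapT => nG.
  have jP i : exists j, ~ V j i z.
    apply: contrapT => nj; apply: nG; exists i => //; apply: FG => j _.
    by apply: VK; apply: contrapT => nV; apply: nj; exists j.+1.
  have [j jH] := choice jP.
  have [_ cVm] := covV (\max_i j i)%N.
  have : (\bigcup_i V (\max_i j i)%N i) z by rewrite cVm.
  move=> [i _ Vz]; apply: (jH i); apply: Vdecr Vz.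
  exact: leq_bigmax.
exists (range G); split.
- exact: finite_image.
- split; first by move=> _ [i _ <-].
  by rewrite bigcup_image.
- by move=> _ [i _ <-]; exists (U i).
- move=> z.
  have -> : [set B | range G B /\ B z] = G @` [set i | G i z].
    apply/seteqP; split => [B [[i _ <-] Gz]|_ [i Gz <-]]; first by exists i.
    by split => //; exists i.
  apply: card_le_trans (card_image_le _ _) _.
  by rewrite card_le_finpred; exact: ordG.
Qed.

End Metric.

(** * Coordinates of the cube *)

Section SetType.
Context {T : topologicalType} (A : set T).

Lemma set_type_nbhs (x : A) (U : set A) : nbhs x U ->
  exists V : set T, [/\ open V, V (\val x) & forall z : A, V (\val z) -> U z].
Proof.
move=> [_ /= [[V oV <-] Vx] VU]; exists V; split => //.
Qed.

Lemma set_val_continuous : continuous (\val : A -> T).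
Proof. exact: initial_continuous. Qed.

Lemma compact_set_type : compact A -> compact [set: A].
Proof.
move=> /compact_near_coveringP cA; apply/compact_near_coveringP.
move=> I F P FF PF.
have : \forall i \near F, A `<=` [set z | forall z' : A, \val z' = z -> P i z'].
  apply: cA => z Az; pose x : A := exist _ z (mem_set Az).
  have [[/= U1 U2] [nU1 FU2] UP] := PF x Logic.I.
  have [V [oV Vx VU1]] := set_type_nbhs nU1.
  exists (V, U2); first by split => //; apply: open_nbhs_nbhs; split.
  move=> [t i] /= [Vt U2i] z' z't; apply: (UP (z', i)); split => //=.
  by move: Vt; rewrite -z't; exact: VU1.
apply: filterS => i AP z _; apply: (AP (\val z)) => //.
exact: set_valP.
Qed.

End SetType.

(** The ranks order the coordinates of the finite and of the infinite cube
    alike, so that both cases are treated at once. *)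
Definition cube_rank {m : option nat} : cube_index m -> nat :=
  if m is Some m' as m0 return cube_index m0 -> nat
  then @nat_of_ord m' else @id nat.

Lemma cube_rank_inj (m : option nat) : injective (@cube_rank m).
Proof. by case: m => [m'|//] i j /= /val_inj. Qed.

#[global] Instance cube_nbhs_filter (R : realType) (m : option nat)
  (q : cube R m) : Filter (nbhs q) := nbhs_filter q.

#[global] Instance cube_nbhs_pfilter (R : realType) (m : option nat)
  (q : cube R m) : ProperFilter (nbhs q) := nbhs_pfilter q.

Section Cube.
Context {R : realType} {m : option nat}.
Local Notation Q := (cube R m).
Local Notation I := (cube_index m).
Implicit Types (q : Q) (u w : I -> R).

Definition coord q (i : I) : R := \val (q i).

Lemma coord_itv q i : 0 <= coord q i <= 1.
Proof.
have : unit_interval R (\val (q i)) by exact: set_valP.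
by rewrite /unit_interval /= in_itv.
Qed.

Lemma coord_inj : injective coord.
Proof.
move=> q q' qq'; apply: functional_extensionality_dep => i.
by apply/val_inj; exact: (congr1 (@^~ i) qq').
Qed.

Lemma coord_surj u : (forall i, 0 <= u i <= 1) -> exists q, coord q = u.
Proof.
move=> u01.
have uP i : u i \in unit_interval R.
  by apply: mem_set; rewrite /unit_interval /= in_itv; exact: u01.
by exists (fun i => exist _ (u i) (uP i)).
Qed.

End Cube.

Lemma coord_continuous (R : realType) (m : option nat) (i : cube_index m) :
  continuous (fun q : cube R m => coord q i).
Proof.
case: m i => [m|] i q; apply: continuous_comp; try exact: initial_continuous.
  exact: (@proj_continuous 'I_m (fun=> unit_interval R) i q).
exact: (@proj_continuous nat (fun=> unit_interval R) i q).
Qed.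

(** The topology is the supremum of those pulled back along the
    coordinates. *)
Lemma cube_map_continuous (R : realType) (m : option nat) (X : topologicalType)
    (h : X -> cube R m) :
  (forall i, continuous (fun x => coord (h x) i)) -> continuous h.
Proof.
move=> ch x; apply/cvg_sup => i U [_ /= [[W oW <-] Wx] WU].
apply: filterS WU _.
case: oW => V oV VW; rewrite -VW in Wx *.
by apply: (ch i x V); exact: open_nbhs_nbhs.
Qed.

Lemma cube_compact (R : realType) (m : option nat) :
  compact [set: cube R m].
Proof.
have cI : compact [set: unit_interval R].
  exact/compact_set_type/segment_compact.
case: m => [m|].
  have := @tychonoff 'I_m (fun=> unit_interval R) (fun=> setT) (fun=> cI).
  by congr compact; apply/seteqP; split.
have := @tychonoff nat (fun=> unit_interval R) (fun=> setT) (fun=> cI).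
by congr compact; apply/seteqP; split.
Qed.

(** * Convexity and coordinate boxes *)

(** Convexity of a set of points of the cube, written in coordinates because the
    cube is not itself a subset of a vector space. *)
Definition convex_pred (R : realType) (I : Type) (P : (I -> R) -> Prop) :=
  forall (t : R) u v, 0 <= t <= 1 -> P u -> P v ->
    P (fun i => (1 - t) * u i + t * v i).

Lemma convex_pred_sum (R : realType) (I K : Type) (P : (I -> R) -> Prop)
    (s : seq K) (c : K -> R) (f : K -> I -> R) :
  convex_pred P -> (forall k, 0 <= c k) -> (forall k, 0 < c k -> P (f k)) ->
  0 < \sum_(k <- s) c k ->
  P (fun i => (\sum_(k <- s) c k * f k i) / \sum_(k <- s) c k).
Proof.
move=> cP c0 cf; elim: s => [|k s IHs]; first by rewrite big_nil ltxx.
rewrite big_cons.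
under [X in _ -> P X]eq_fun do rewrite big_cons.
have S0 : 0 <= \sum_(k <- s) c k by exact: sumr_ge0.
have [ck0|ck0] := eqVneq (c k) 0.
  rewrite ck0 add0r => /IHs.
  by congr P; apply/funext => i; rewrite mul0r add0r.
have {ck0}ck0 : 0 < c k by rewrite lt_neqAle eq_sym ck0 c0.
move: S0; rewrite le_eqVlt => /predU1P[S0|S0] _.
  rewrite -S0 addr0 (_ : (fun i => _) = f k); first exact: cf.
  have z (g : K -> R) : \sum_(k <- s) c k * g k = 0.
    elim: s S0 {IHs} => [|k' s IHs]; first by rewrite !big_nil.
    have ? : 0 <= \sum_(k <- s) c k by exact: sumr_ge0.
    rewrite !big_cons => /eqP; rewrite eq_sym paddr_eq0// => /andP[/eqP -> /eqP].
    by rewrite mul0r add0r => /esym/IHs.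
  by apply/funext => i; rewrite z addr0 mulrAC divff ?mul1r ?gt_eqF.
set C := \sum_(k <- s) c k in S0 IHs *.
rewrite (_ : (fun i => _) = fun i => (1 - C / (c k + C)) * f k i +
   C / (c k + C) * ((\sum_(k <- s) c k * f k i) / C)).
  apply: cP; [|exact: cf|exact: IHs].
  by apply/andP; split; [apply: divr_ge0; lra|rewrite ler_pdivrMr; lra].
by apply/funext => i; field; apply/andP; split; apply: lt0r_neq0; lra.
Qed.

Lemma convex_pred_bary (R : realType) (I K : Type) (P : (I -> R) -> Prop)
    (s : seq K) (c : K -> R) (f : K -> I -> R) :
  convex_pred P -> (forall k, 0 <= c k) -> (forall k, 0 < c k -> P (f k)) ->
  \sum_(k <- s) c k = 1 -> P (fun i => \sum_(k <- s) c k * f k i).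
Proof.
move=> cP c0 cf c1; have := @convex_pred_sum R I K P s c f cP c0 cf.
rewrite c1 => /(_ ltr01).
by congr P; apply/funext => i; rewrite divr1.
Qed.

Lemma convex_pred_rest (R : realType) (I K : Type) (P : (I -> R) -> Prop)
    (s : seq K) (c : K -> R) (h : K -> I -> R) (w : I -> R) :
  convex_pred P -> (forall k, 0 <= c k) -> (forall k, 0 < c k -> P (h k)) ->
  \sum_(k <- s) c k <= 1 -> P w ->
  P (fun i => \sum_(k <- s) c k * h k i + (1 - \sum_(k <- s) c k) * w i).
Proof.
move=> cP c0 ch s1 Pw; pose S := \sum_(k <- s) c k.
have := @convex_pred_bary R I (option K) P (None :: [seq Some k | k <- s])
  (fun o => if o is Some k then c k else 1 - S)
  (fun o => if o is Some k then h k else w) cP.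
move=> /(_ _ _ _)/wrap[]; [by case=> [//|]; rewrite subr_ge0|by case|..].
  by rewrite big_cons big_map/= subrK.
by congr P; apply/funext => i; rewrite big_cons big_map/= addrC.
Qed.

Definition unit_valued (R : realType) (I : Type) (u : I -> R) :=
  forall i, 0 <= u i <= 1.

Lemma unit_valued_convex (R : realType) (I : Type) :
  convex_pred (@unit_valued R I).
Proof.
move=> t u v /andP[t0 t1] u01 v01 i.
have /andP[u0 u1] := u01 i; have /andP[v0 v1] := v01 i.
have h1 : 0 <= (1 - t) * u i by apply: mulr_ge0; lra.
have h2 : 0 <= (1 - t) * (1 - u i) by apply: mulr_ge0; lra.
have h3 : 0 <= t * v i by exact: mulr_ge0.
have h4 : 0 <= t * (1 - v i) by apply: mulr_ge0; lra.
by apply/andP; split; lra.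
Qed.

Section Boxes.
Context {R : realType} {m : option nat}.
Local Notation Q := (cube R m).
Local Notation I := (cube_index m).
Implicit Types (q : Q) (u v w : I -> R) (j : nat).

(** The boxes form a countable base of the uniformity of the cube.  What matters
    is that they are convex and decreasing in [j], so that finitely many boxes
    around a point lie in the largest of them; the balls of an arbitrary
    compatible metric need not be convex. *)
Definition box j u w := forall i, (cube_rank i < j)%N -> `|u i - w i| < 2^-1 ^+ j.

Lemma box_sym j u w : box j u w -> box j w u.
Proof. by move=> uw i /uw; rewrite distrC. Qed.

Lemma box_le j j' u w : (j <= j')%N -> box j' u w -> box j u w.
Proof.
move=> jj' uw i ij; apply: lt_le_trans (uw i _) _; first exact: leq_trans ij _.
by apply: ler_wiXn2l => //; lra.
Qed.

Lemma box_trans j u v w : box j.+1 u v -> box j.+1 v w -> box j u w.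
Proof.
move=> uv vw i ij; have ij' : (cube_rank i < j.+1)%N by exact: ltnW.
have := uv i ij'; have := vw i ij'; rewrite exprS.
move: (2^-1 ^+ j) => e vwi uvi.
have := ler_distD (v i) (u i) (w i); lra.
Qed.

Lemma box_convex j w : convex_pred (fun u => box j u w).
Proof.
move=> t u v /andP[t0 t1] uw vw i ij; have := uw i ij; have := vw i ij.
rewrite !ltr_norml.
have -> : (1 - t) * u i + t * v i - w i = (1 - t) * (u i - w i) + t * (v i - w i).
  by ring.
move: (u i - w i) (v i - w i) (2^-1 ^+ j) => a b e /andP[be eb] /andP[ae ea].
have [->|tn0] := eqVneq t 0; first by apply/andP; split; lra.
have {tn0}t0 : 0 < t by rewrite lt_neqAle eq_sym tn0.
have h1 : 0 < t * (e - b) by rewrite mulr_gt0// subr_gt0.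
have h2 : 0 < t * (b + e) by apply: mulr_gt0 => //; lra.
have h3 : 0 <= (1 - t) * (e - a) by apply: mulr_ge0; lra.
have h4 : 0 <= (1 - t) * (a + e) by apply: mulr_ge0; lra.
by apply/andP; split; lra.
Qed.

Lemma box_nbhs q j : \forall q' \near q, box j (coord q) (coord q').
Proof.
have : \forall q' \near q, forall r : 'I_j, forall i : I, cube_rank i = r ->
    `|coord q i - coord q' i| < 2^-1 ^+ j.
  apply: (@filter_forall _ _ _ (nbhs q)) => r.
  have [[i ir]|ni] := pselect (exists i : I, cube_rank i = r).
    have := @coord_continuous R m i q => /cvgrPdist_lt/(_ (2^-1 ^+ j)).
    rewrite exprn_gt0// => /(_ isT); apply: filterS => q' qq' i' i'r.
    by rewrite (@cube_rank_inj _ i' i)// ir i'r.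
  by apply: nearW => q' i ir; exfalso; apply: ni; exists i.
by apply: filterS => q' qq' i ij; exact: (qq' (Ordinal ij)).
Qed.

(** The boxes around [q] shrink to [q], and the complement of an open
    neighbourhood of [q] is compact. *)
Lemma nbhs_box q (A : set Q) : nbhs q A ->
  exists j, forall q', box j (coord q) (coord q') -> A q'.
Proof.
rewrite nbhsE => -[B [oB Bq] BA].
have cB : compact (~` B).
  apply: (@subclosed_compact _ _ setT) => //; first exact: open_closedC.
  exact: cube_compact.
have : \forall j \near \oo, ~` B `<=` [set q' | ~ box j (coord q) (coord q')].
  move/compact_near_coveringP: cB; apply => q' nBq'.
  have [i qi] : exists i, coord q i != coord q' i.
    apply: contrapT => /forallNP qq'; apply: nBq'.
    rewrite (_ : q' = q)//; apply: coord_inj; apply/funext => i.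
    by have /negP := qq' i; rewrite negbK => /eqP.
  pose e := `|coord q i - coord q' i| / 2.
  have e0 : 0 < e by rewrite divr_gt0// normr_gt0 subr_eq0.
  near=> q'' j => /= /(_ i) qb.
  have ij : (cube_rank i < j)%N by near: j; exact: nbhs_infty_gt.
  have je : 2^-1 ^+ j < e by near: j; exact: exp2V_lt.
  have : `|coord q' i - coord q'' i| < e.
    near: q''; have := @coord_continuous R m i q'.
    by move=> /cvgrPdist_lt/(_ e e0).
  have := qb ij; have := ler_distD (coord q'' i) (coord q i) (coord q' i).
  rewrite (distrC (coord q'' i)); move: je; rewrite /e; lra.
move=> [j _ /(_ j (leqnn _)) jB]; exists j => q' qq'; apply: BA.
by apply: contrapT => nB; exact: jB nB qq'.
Unshelve. all: by end_near. Qed.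

Lemma box_lebesgue (K : Type) (C : set Q) (U : K -> set Q) :
  compact C -> (forall k, open (U k)) -> C `<=` \bigcup_k U k ->
  exists j, forall q, C q -> exists k, forall q', box j (coord q) (coord q') -> U k q'.
Proof.
move=> /compact_near_coveringP cC oU CU.
have : \forall j \near \oo, C `<=`
    [set q | exists k, forall q', box j (coord q) (coord q') -> U k q'].
  apply: cC => q /CU[k _ Uq].
  have [j jU] := nbhs_box (open_nbhs_nbhs (conj (oU k) Uq)).
  near=> q' j' => /=; exists k => q'' qq''; apply: jU.
  apply: (@box_trans _ _ (coord q')).
    by near: q'; exact: box_nbhs.
  by apply: box_le qq''; near: j'; exact: nbhs_infty_ge.
by move=> [j _ /(_ j (leqnn _)) jB]; exists j.
Unshelve. all: by end_near. Qed.

End Boxes.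

(** * Finitely many simplices in general position *)

(** At most [n + 1] points of an [(n + 1)]-dimensional space lie in a common
    affine hyperplane: the matrix with these columns, bordered by a row of ones,
    has more rows than columns. *)
Lemma exists_hyperplane (F : fieldType) (K : finType) (n : nat) (T : {set K})
    (x : K -> 'I_n.+1 -> F) : (#|T| <= n.+1)%N ->
  exists (a : 'I_n.+1 -> F) (b : F), (exists i, a i != 0) /\
    forall k, k \in T -> \sum_i a i * x k i = b.
Proof.
move=> Tn; have [T0|/set0Pn[k0 Tk0]] := eqVneq T finset.set0.
  exists (fun=> 1), 0; split; first by exists ord0; exact: oner_neq0.
  by move=> k; rewrite T0 inE.
pose M : 'M[F]_(n.+1 + 1, #|T|) := \matrix_(i, k)
  match fintype.split i with inl i => x (enum_val k) i | inr _ => 1 end.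
have /rowV0Pn[v /sub_kermxP vM v0] : kermx M != 0.
  rewrite kermx_eq0 /row_free neq_ltn; apply/orP; left.
  by apply: leq_ltn_trans (rank_leq_col _) _; rewrite addn1 ltnS.
have vk k : k \in T -> \sum_i v 0 (lshift 1 i) * x k i = - v 0 (rshift n.+1 0).
  move=> Tk; have := congr1 (fun A : 'rV__ => A 0 (enum_rank_in Tk k)) vM.
  rewrite !mxE big_split_ord /= big_ord1 !mxE.
  have := unsplitK (inr 0 : 'I_n.+1 + 'I_1) => /= ->; rewrite mulr1 => /eqP.
  rewrite addr_eq0 => /eqP <-; apply: eq_bigr => i _; rewrite !mxE.
  have := unsplitK (inl i : 'I_n.+1 + 'I_1) => /= ->.
  by rewrite enum_rankK_in.
exists (fun i => v 0 (lshift 1 i)), (- v 0 (rshift n.+1 0)); split => //.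
apply: contrapT => /forallNP av; move/eqP: v0; apply.
have a0 i : v 0 (lshift 1 i) = 0 by apply/eqP/negP => /negP/av.
have b0 : v 0 (rshift n.+1 0) = 0.
  apply/eqP; rewrite -oppr_eq0 -(vk k0 Tk0) big1 // => i _.
  by rewrite a0 mul0r.
apply/rowP => i; rewrite mxE; case: (split_ordP i) => j ->; first exact: a0.
by rewrite ord1.
Qed.

Lemma poly_nonroot01 (R : realType) (p : {poly R}) : p != 0 ->
  exists2 s, 0 < s < 1 & ~~ root p s.
Proof.
move=> p0; apply: contrapT => np.
pose rs := [seq (k.+2%:R : R)^-1 | k <- iota 0 (size p)].
have urs : uniq rs.
  rewrite map_inj_uniq ?iota_uniq// => k l /invr_inj /eqP.
  by rewrite eqr_nat => /eqP [].
have : (size rs < size p)%N.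
  apply: max_poly_roots => //; apply/allP => s /mapP[k _ ->].
  apply: contrapT => /negP nr; apply: np; exists k.+2%:R^-1 => //.
  by rewrite invr_gt0 ltr0n/= invf_lt1 ?ltr1n ?ltr0n.
by rewrite size_map size_iota ltnn.
Qed.

Lemma avoid_roots (R : realType) (K : finType) (p : K -> {poly R}) :
  (forall k, p k != 0) -> exists2 s, 0 < s < 1 & forall k, ~~ root (p k) s.
Proof.
move=> p0; have [|s s01 ns] := @poly_nonroot01 R (\prod_k p k).
  by apply/prodf_neq0 => k _.
exists s => // k; apply: contra ns; rewrite /root (bigD1 k)//= hornerM.
by move/eqP ->; rewrite mul0r.
Qed.

Section GeneralPosition.
Context {R : realType} {m : option nat}.
Local Notation Q := (cube R m).
Local Notation I := (cube_index m).

(** Covering dimension at most [n], seen at scale [j]: a cover of order at most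
    [n] by sets of the size of a box, given in the form of [n + 1] disjoint
    families.  Only the open sets [B] and not a relative topology are involved,
    hence the property passes from [C] to a neighbourhood of [C]. *)
Definition small_cover (j n : nat) (C : set Q) :=
  exists B : 'I_n.+1 -> set (set Q), [/\ forall a, B a `<=` open,
    forall a U U' q, B a U -> B a U' -> U q -> U' q -> U = U',
    forall a U q q', B a U -> U q -> U q' -> box j (coord q) (coord q') &
    C `<=` \bigcup_a \bigcup_(U in B a) U].

(** The value 0 stands for the missing coordinates of a finite cube. *)
Definition rank_coord (r : nat) (u : I -> R) : R :=
  if pselect (exists i : I, cube_rank i = r) is left e then u (projT1 (cid e))
  else 0.

Lemma rank_coordE (u : I -> R) i : rank_coord (cube_rank i) u = u i.
Proof.
rewrite /rank_coord; case: pselect => [e|[]]; last by exists i.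
by congr u; apply: cube_rank_inj; exact: projT2 (cid e).
Qed.

Lemma rank_coord_itv r (q : Q) : 0 <= rank_coord r (coord q) <= 1.
Proof.
by rewrite /rank_coord; case: pselect => [e|_]; rewrite ?coord_itv ?lexx ?ler01.
Qed.

Lemma rank_coord_continuous r : continuous (fun q : Q => rank_coord r (coord q)).
Proof.
rewrite /rank_coord; case: pselect => [e|_]; first exact: coord_continuous.
exact: cst_continuous.
Qed.

Lemma rank_coord_convex r (t : R) (u v : I -> R) :
  rank_coord r (fun i => (1 - t) * u i + t * v i) =
  (1 - t) * rank_coord r u + t * rank_coord r v.
Proof.
by rewrite /rank_coord; case: pselect => [//|_]; rewrite !mulr0 addr0.
Qed.

Lemma hyperplane_convex (K : finType) (a : K -> R) (c : K -> nat) (b : R) :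
  convex_pred (fun u : I -> R => \sum_k a k * rank_coord (c k) u = b).
Proof.
move=> t u v _ ub vb.
under eq_bigr do rewrite rank_coord_convex mulrDr !(mulrCA (a _)).
by rewrite big_split/= -!mulr_sumr ub vb; ring.
Qed.

(** The exponents are positive and pairwise distinct modulo [n + 1], so none of
    the terms [a i] can cancel. *)
Lemma cut_poly_neq0 (n : nat) (a : 'I_n.+1 -> R) (b : R) (c l : 'I_n.+1 -> nat) :
  (exists i, a i != 0) ->
  \sum_i a i *: ('X^((c i * n.+1 + i).+1) + (l i)%:R%:P) - b%:P != 0.
Proof.
move=> [i0 ai0]; apply: contra ai0 => /eqP/(congr1 (coefp (c i0 * n.+1 + i0).+1)).
rewrite /= coef0 coefB coefC subr0 coef_sum (bigD1 i0)//=.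
rewrite big1 => [|i ii0].
  by rewrite addr0 coefZ coefD coefXn eqxx coefC addr0 mulr1 => /eqP.
rewrite coefZ coefD coefXn coefC addr0 eqSS (_ : (_ == _)%N = false) ?mulr0//.
apply/eqP => /(congr1 (modn^~ n.+1)); rewrite !modnMDl !modn_small// => /val_inj.
by move/eqP; rewrite eq_sym (negPf ii0).
Qed.

(** For each of [n + 1] colours, cut the cube into cells by hyperplanes
    perpendicular to the coordinates of rank below [j], placed periodically with
    period [1 / D] and with a shift that depends on the colour and the coordinate.
    A point missed by the cells of every colour satisfies [n + 1] equations,
    each prescribing one coordinate.  A point of an [n]-simplex also satisfies a
    linear relation between the coordinates concerned, with coefficients that
    depend only on the simplex and on which coordinates these are.  If the shifts are suitable powers of one number
    [s], the two conditions together say that [s] is a root of one of finitely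
    many nonzero polynomials, and [s] can be chosen not to be. *)
Lemma simplices_small_cover (N n j : nat) (W : 'I_N -> I -> R) :
  small_cover j n [set q | exists T : {set 'I_N}, (#|T| <= n.+1)%N /\
    forall P, convex_pred P -> (forall k, k \in T -> P (W k)) -> P (coord q)].
Proof.
(* Cells have side [1 / D], which is smaller than the size [2^-j] of a box. *)
pose D := (2 ^ j).+1%N.
have D0 : 0 < D%:R :> R by rewrite ltr0n.
have hypP (Tc : {set 'I_N} * {ffun 'I_n.+1 -> 'I_j}) :
    exists ab : ('I_n.+1 -> R) * R, (#|Tc.1| <= n.+1)%N ->
      (exists i, ab.1 i != 0) /\ forall k, k \in Tc.1 ->
      \sum_i ab.1 i * rank_coord (Tc.2 i) (W k) = ab.2.
  have [Tn|] := leqP #|Tc.1| n.+1; last by exists (fun=> 0, 0).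
  by have [a [b]] := exists_hyperplane (fun k i => rank_coord (Tc.2 i) (W k)) Tn;
    exists (a, b).
have [hyp hypH] := choice hypP.
pose pol (Tcl : {set 'I_N} * {ffun 'I_n.+1 -> 'I_j} * {ffun 'I_n.+1 -> 'I_D.+1}) :=
  let: (Tc, l) := Tcl in let: (a, b) := hyp Tc in
  if (#|Tc.1| <= n.+1)%N then
  \sum_i a i *: ('X^((Tc.2 i * n.+1 + i).+1) + (l i : nat)%:R%:P) -
    (\sum_i a i + D%:R * b)%:P else 1.
have [|s s01 sP] := @avoid_roots R _ pol.
  move=> [Tc l]; rewrite /pol; have := hypH Tc; case: (hyp Tc) => a b.
  case: ifPn => [_ /(_ isT)[a0 _]|_ _]; last exact: oner_neq0.
  exact: (@cut_poly_neq0 n a _ (fun i => Tc.2 i) (fun i => l i) a0).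
pose th (r : 'I_j) (a : 'I_n.+1) := s ^+ (r * n.+1 + a).+1.
have th01 r a : 0 < th r a < 1.
  have /andP[s0 s1] := s01.
  by rewrite exprn_gt0//= exprn_ilt1 ?ltW.
(* Adding 1 makes the label of a cell a natural number, since the shifts
   are smaller than 1. *)
pose z r (q : Q) := rank_coord r (coord q) * D%:R + 1.
pose cell a (l : {ffun 'I_j -> 'I_D.+1}) := [set q | forall r : 'I_j,
  (l r)%:R + th r a < z r q /\ z r q < (l r)%:R + th r a + 1].
have cz r : continuous (z r).
  by move=> q; apply: cvgD; [apply: cvgMl; exact: rank_coord_continuous|exact: cvg_cst].
exists (fun a => range (cell a)); split.
- move=> a _ [l _ <-]; rewrite openE => q lq.
  apply: (@filter_forall _ _ _ (nbhs q)) => r.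
  apply: filterS (_ : nbhs q ([set q | (l r)%:R + th r a < z r q] `&`
                              [set q | z r q < (l r)%:R + th r a + 1])).
    by move=> q' [].
  apply: open_nbhs_nbhs; split; last exact: lq.
  by apply: openI; apply: open_lt_fun => //; move=> ?; exact: cvg_cst.
- move=> a _ _ q [l _ <-] [l' _ <-] lq l'q; congr cell; apply/ffunP => r.
  have [h1 h2] := lq r; have [h3 h4] := l'q r; apply/val_inj => /=.
  have : (l r)%:R < (l' r).+1%:R :> R by rewrite -natr1; lra.
  have : (l' r)%:R < (l r).+1%:R :> R by rewrite -natr1; lra.
  by rewrite !ltr_nat; lia.
- move=> a _ q q' [l _ <-] lq lq' i ij.
  have [h1 h2] := lq (Ordinal ij); have [h3 h4] := lq' (Ordinal ij).
  move: h1 h2 h3 h4; rewrite /z /= !rank_coordE.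
  move: (th _ _) (nat_of_ord _)%:R => ? ?; move=> h1 h2 h3 h4.
  have jD : 2 ^+ j < D%:R :> R by rewrite -natrX ltr_nat.
  rewrite exprVn -[X in _ < X]div1r ltr_pdivlMr ?exprn_gt0//.
  apply: (@le_lt_trans _ _ (`|coord q i - coord q' i| * D%:R)).
    by apply: ler_wpM2l => //; exact: ltW.
  rewrite -[D%:R]gtr0_norm// -normrM mulrBl ltr_norml.
  by apply/andP; split; lra.
- move=> q [T [Tn hull]]; apply: contrapT => nq.
  (* If no cell of colour [a] contains [q], then [q] lies on a cut. *)
  have cutP a : exists rl : 'I_j * 'I_D.+1, z rl.1 q = rl.2%:R + th rl.1 a.
    apply: contrapT => /forallNP ncut; apply: nq; exists a => //.
    have t0 (r : 'I_j) : 0 < z r q - th r a.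
      have := th01 r a; have /andP[+ _] := rank_coord_itv r q.
      rewrite /z => h /andP[_ h']; have : 0 <= rank_coord r (coord q) * D%:R.
        by rewrite mulr_ge0 ?ler0n.
      lra.
    have tr (r : 'I_j) : (Num.truncn (z r q - th r a) < D.+1)%N.
      have : (Num.truncn (z r q - th r a))%:R < D.+1%:R :> R.
        apply: le_lt_trans (_ : z r q - th r a < _).
          by have /andP[] := truncn_itv (ltW (t0 r)).
        have := th01 r a; have /andP[_ +] := rank_coord_itv r q.
        rewrite /z -natr1 => h /andP[h' _].
        have : rank_coord r (coord q) * D%:R <= 1 * D%:R by rewrite ler_wpM2r ?ler0n.
        lra.
      by rewrite ltr_nat.
    exists (cell a [ffun r => Ordinal (tr r)]).
      by exists [ffun r => Ordinal (tr r)].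
    move=> r; rewrite ffunE /=; have := truncn_itv (ltW (t0 r)).
    rewrite -natr1 => /andP[h1 h2]; split; last by lra.
    rewrite -ltrBrDr lt_neqAle h1 andbT; apply/eqP => e.
    by apply: (ncut (r, Ordinal (tr r))) => /=; rewrite e; lra.
  have [rl rlH] := choice cutP.
  pose c := [ffun a => (rl a).1]; pose l := [ffun a => (rl a).2].
  have := sP (T, c, l); rewrite /pol; have := hypH (T, c).
  case: (hyp (T, c)) => a b /(_ Tn)[_ /= ab].
  rewrite Tn => /negP; apply.
  have /= := hull _ (@hyperplane_convex _ a (fun i => c i) b) ab => qb.
  rewrite /root hornerD hornerN hornerC horner_sum subr_eq0; apply/eqP.
  rewrite -qb mulr_sumr -big_split/=; apply: eq_bigr => i _.
  rewrite hornerZ hornerD hornerXn hornerC.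
  have := rlH i; rewrite /z /th /c /l !ffunE /= => e.
  have -> : s ^+ ((rl i).1 * n.+1 + i).+1 =
      rank_coord (rl i).1 (coord q) * D%:R + 1 - (rl i).2%:R.
    by rewrite e; ring.
  by ring.
Qed.

End GeneralPosition.

(** * Truncation of the order, and charts *)

(** Subtract from all [q k] a function [e] that is at least the minimum of any
    [n + 1] of them, and keep the positive parts: [n + 1] of these cannot be
    positive at once.  The sum of all such minima serves as [e]; it vanishes
    where at most [n] of the [q k] are positive. *)
Lemma truncate_order (R : realType) (T : topologicalType) (N n : nat)
    (q : 'I_N -> T -> R) :
  (forall k, continuous (q k)) -> (forall k x, 0 <= q k x) ->
  exists r : 'I_N -> T -> R, [/\ forall k, continuous (r k),
    forall k x, 0 <= r k x, forall k x, 0 < r k x -> 0 < q k x,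
    forall x, (#|[pred k | (0 < r k x)%R]| <= n)%N &
    forall x, (#|[pred k | (0 < q k x)%R]| <= n)%N -> forall k, r k x = q k x].
Proof.
move=> cq q0.
pose S x := \sum_(k <- enum 'I_N) q k x.
(* The starting value [S x] of the minimum is at least each [q k x]. *)
pose h (A : {set 'I_N}) x := \big[Num.min/S x]_(k <- enum 'I_N | k \in A) q k x.
pose sets := [seq A : {set 'I_N} <- enum {set 'I_N} | #|A| == n.+1].
pose e x := \sum_(A <- sets) h A x.
have S0 x : 0 <= S x by exact: sumr_ge0.
have h0 A x : 0 <= h A x by apply: le_bigmin.
have e0 x : 0 <= e x by exact: sumr_ge0.
have qS k x : q k x <= S x.
  by rewrite /S (bigD1_seq k) ?mem_enum ?enum_uniq//= lerDl sumr_ge0.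
have ce : continuous e.
  apply: continuous_sum => A; apply: continuous_bigmin => //.
  exact: continuous_sum.
exists (fun k x => Num.max (q k x - e x) 0); split.
- by move=> k; exact: continuous_posB.
- by move=> k x; rewrite le_max lexx orbT.
- move=> k x; rewrite lt_max ltxx orbF subr_gt0; exact: le_lt_trans.
- move=> x; rewrite leqNgt; apply/negP => ltn.
  pose B := [set k | 0 < Num.max (q k x - e x) 0]%SET.
  have [A AB cA] : exists2 A : {set 'I_N}, A \subset B & #|A| = n.+1.
    have nB : (n.+1 <= #|B|)%N by rewrite cardsE.
    exists [set k in take n.+1 (enum B)]%SET.
      apply/fintype.subsetP => k; rewrite inE => /mem_take.
      by rewrite mem_enum.
    rewrite cardsE (card_uniqP _) ?take_uniq ?enum_uniq//.
    by rewrite size_takel// -cardE.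
  have hA k : k \in A -> h A x < q k x.
    move=> /(fintype.subsetP AB); rewrite inE lt_max ltxx orbF subr_gt0.
    apply: le_lt_trans; rewrite /e (bigD1_seq A)/=.
    - by rewrite lerDl sumr_ge0.
    - by rewrite mem_filter cA eqxx mem_enum.
    - by rewrite filter_uniq ?enum_uniq.
  have [k kA] : exists k, k \in A.
    by apply/set0Pn; rewrite -card_gt0 cA.
  have : h A x < h A x; last by rewrite ltxx.
  rewrite {2}/h big_enum_cond/=; apply/bigmin_gtP; split.
    exact: lt_le_trans (hA _ kA) (qS _ _).
  by move=> k' /= /hA.
- move=> x qn k.
  have -> : e x = 0.
    rewrite /e big_seq big1// => A; rewrite mem_filter => /andP[/eqP cA _].
    have [k' k'A qk'] : exists2 k, k \in A & q k x = 0.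
      apply: contrapT => nk; move: qn; rewrite leqNgt -cA => /negP; apply.
      apply: subset_leq_card; apply/fintype.subsetP => k' k'A; rewrite inE.
      rewrite lt_neqAle q0 andbT eq_sym; apply/eqP => qk'.
      by apply: nk; exists k'.
    apply/eqP; rewrite eq_le h0 andbT -qk' /h big_enum_cond/=.
    exact: bigmin_le_cond.
  by rewrite subr0; apply/max_idPl.
Qed.

(** A map defined over [chart_dom]: the bump functions are barycentric
    coordinates in an abstract complex whose vertices are placed at the points
    [vertex k] of the cube. *)
Record chart (R : realType) (I : Type) (X Y : Type) := Chart {
  chart_dom : set Y;
  chart_size : nat;
  bump : 'I_chart_size -> X -> R;
  vertex : 'I_chart_size -> I -> R }.

HB.instance Definition _ R I X Y := gen_eqMixin (chart R I X Y).
HB.instance Definition _ R I X Y := gen_choiceMixin (chart R I X Y).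

(** The point [x0] excludes vertices with an empty star, for which there may be
    no vertex of [c'] at all. *)
Definition chart_refines (R : realType) (I : Type) (X Y : Type)
    (c c' : chart R I X Y) :=
  forall (k : 'I_(chart_size c)) x0, 0 < bump k x0 ->
    exists k' : 'I_(chart_size c'), forall x, 0 < bump k x -> 0 < bump k' x.

(** * Blending charts by a random walk *)

Section Blend.
Context {R : realType} {I X Y : Type}.
Local Notation chart := (chart R I X Y).
Variables (phi : nat -> Y -> R) (ch : nat -> Y -> chart).

(** A vertex is recorded by its star in [X] and its position, which makes
    vertices of different charts comparable. *)
Definition chart_elt (c : chart) (k : 'I_(chart_size c)) : set X * (I -> R) :=
  ([set x | 0 < bump k x], vertex k).

(** Passage to a vertex of [c] with a larger star.  When there is none the state
    is kept, so that the star never shrinks. *)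
Definition descend (c : chart) (s : set X * (I -> R)) : set X * (I -> R) :=
  if [pick k : 'I_(chart_size c) | `[< s.1 `<=` (chart_elt k).1 >]] is Some k
  then chart_elt k else s.

(** Expected final position of a random walk that starts at the state [s] and
    goes through the levels [i - 1, ..., 0], descending at level [l] to the chart
    [ch l y] with probability [phi l y]. *)
Fixpoint expected (i : nat) (y : Y) (s : set X * (I -> R)) : I -> R :=
  if i is i'.+1 then fun a =>
    (1 - phi i' y) * expected i' y s a +
    phi i' y * expected i' y (descend (ch i' y) s) a
  else s.2.

Variables (f : X -> Y) (w : X -> I -> R).

(** The same walk started at a point [x] instead of a vertex: the first time it
    moves, it picks a vertex of the chart with the barycentric coordinates of [x]
    as probabilities, or it stops at [w x] with the remaining probability.  The
    position is [w x] also if it never moves. *)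
Fixpoint blend (i : nat) (x : X) : I -> R :=
  if i is i'.+1 then fun a =>
    (1 - phi i' (f x)) * blend i' x a +
    phi i' (f x) * (\sum_(k < chart_size (ch i' (f x)))
        bump k x * expected i' (f x) (chart_elt k) a +
      (1 - \sum_(k < chart_size (ch i' (f x))) bump k x) * w x a)
  else w x.

Lemma descend_sub c s : s.1 `<=` (descend c s).1.
Proof. by rewrite /descend; case: pickP => [k /asboolP sk|_] //; exact: sk. Qed.

Lemma descend_elt c s : descend c s = s \/
  exists k : 'I_(chart_size c), descend c s = chart_elt k.
Proof. by rewrite /descend; case: pickP => [k _|_]; [right; exists k|left]. Qed.

Lemma descend_refined c c' (k : 'I_(chart_size c)) x : chart_refines c c' ->
  (chart_elt k).1 x -> exists2 k' : 'I_(chart_size c'),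
    descend c' (chart_elt k) = chart_elt k' & (chart_elt k').1 x.
Proof.
move=> cc' kx; rewrite /descend; case: pickP => [k' /asboolP kk'|nk].
  by exists k' => //; exact: kk'.
have [k' k'P] := cc' k x kx; have := nk k'.
by move/negbT/asboolP; case.
Qed.

Lemma expected_ind (i : nat) y (P : (I -> R) -> Prop) (G : set (set X * (I -> R))) :
  convex_pred P -> (forall l y, 0 <= phi l y <= 1) ->
  (forall s, G s -> P s.2) ->
  (forall l s, G s -> G (descend (ch l y) s)) ->
  forall s, G s -> P (expected i y s).
Proof.
move=> cP phi01 GP Gm; elim: i => [|i IHi] s Gs; first exact: GP.
apply: cP; [exact: phi01|exact: IHi|].
by apply/IHi/Gm.
Qed.

End Blend.

(** * Refining levels of charts along the fibres *)

Section Density.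
Context {R : realType} {m : option nat} {X Y : topologicalType}.
Local Notation Q := (cube R m).
Local Notation I := (cube_index m).
Variables (d : Q -> Q -> R) (n : nat) (f : X -> Y) (A : set X).
Variables (g0 : X -> Q) (alpha : X -> R).
Hypotheses (hd : compatible_metric d) (pX : paracompact X) (pY : paracompact Y).
Hypotheses (hC : C_space Y) (cf : continuous f) (clA : closed A).
Hypotheses (fA_closed : forall C, closed C -> closed (f @` (A `&` C))).
Hypotheses (fA_compact : forall y, compact (A `&` f @^-1` [set y])).
Hypotheses (fdim : dim_map_le f n).
Hypotheses (cg0 : continuous g0) (calpha : continuous alpha).
Hypothesis alpha0 : forall x, 0 < alpha x.

(** The positions allowed for the image of [x]: a convex set that contains
    [g0 x], lies within distance [alpha x] of it, and is such that [g0 x] is also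
    allowed for the points near [x]. *)
Definition admissible (x : X) (u : I -> R) :=
  exists j, box j u (coord (g0 x)) /\
    forall q, box j (coord q) (coord (g0 x)) -> d (g0 x) q <= alpha x.

Lemma admissible_convex x : convex_pred (admissible x).
Proof.
move=> t u v t01 [j [uj jP]] [j' [vj' j'P]].
have [jj'|/ltnW j'j] := leqP j j'.
  by exists j; split => //; apply: box_convex => //; exact: box_le vj'.
by exists j'; split => //; apply: box_convex => //; exact: box_le uj.
Qed.

Lemma admissible_near x : \forall x' \near x, admissible x' (coord (g0 x)).
Proof.
have a4 : 0 < alpha x / 4 by rewrite divr_gt0.
have [j jP] := nbhs_box (cmetric_near hd (g0 x) a4).
near=> x'.
have xx' : box j.+1 (coord (g0 x)) (coord (g0 x')).
  by near: x'; exact: (@cg0 x _ (box_nbhs (g0 x) j.+1)).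
have ax' : alpha x / 2 < alpha x'.
  near: x'; have := @calpha x => /cvgrPdist_lt/(_ (alpha x / 2)).
  rewrite divr_gt0// => /(_ isT); apply: filterS => x'; rewrite ltr_norml.
  by move=> /andP[]; lra.
exists j.+1; split => // q qx'.
have h1 : d (g0 x) q < alpha x / 4.
  by apply: jP; apply: box_trans xx' (box_sym qx').
have h2 : d (g0 x) (g0 x') < alpha x / 4 by apply/jP/(box_le _ xx').
have := cmetric_triangle hd (g0 x') (g0 x) q.
rewrite [d (g0 x') (g0 x)](cmetric_sym hd); lra.
Unshelve. all: by end_near. Qed.

Lemma admissible_refl x : admissible x (coord (g0 x)).
Proof. exact: nbhs_singleton (admissible_near x). Qed.

Lemma admissible_close x q : admissible x (coord q) -> d (g0 x) q <= alpha x.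
Proof. by move=> [j [qj]]; apply. Qed.

(** This is where [f] being a closed map on [A] enters. *)
Lemma fiber_tube (y : Y) (O : set X) : open O -> A `&` f @^-1` [set y] `<=` O ->
  exists V, [/\ open V, V y & A `&` f @^-1` V `<=` O].
Proof.
move=> oO KO; exists (~` (f @` (A `&` ~` O))); split.
- by apply: closed_openC; apply: fA_closed; exact: open_closedC.
- by move=> [x [Ax nOx] fxy]; apply: nOx; exact: KO.
- move=> x [Ax nfx]; apply: contrapT => nOx; apply: nfx; exists x => //.
Qed.

Local Notation chart := (chart R I X Y).

Definition void_chart : chart :=
  @Chart R I X Y set0 0 (fun _ _ => 0) (fun _ _ => 0).

(** Off the part of [A] that lies over the domain, the bump functions may sum to
    less than 1; the missing weight will go to [g0].  This spares the extension
    of maps from [A] to [X]. *)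
Definition valid_chart (c : chart) :=
  [/\ open (chart_dom c),
      (forall k : 'I_(chart_size c), continuous (bump k)) /\
      (forall (k : 'I_(chart_size c)) x, 0 <= bump k x),
      (forall x, \sum_(k < chart_size c) bump k x <= 1) /\
      (forall x, A x -> chart_dom c (f x) -> \sum_(k < chart_size c) bump k x = 1),
      (forall x, (#|[pred k : 'I_(chart_size c) | (0 < bump k x)%R]| <= n.+1)%N)
    & (forall (k : 'I_(chart_size c)) x, 0 < bump k x -> admissible x (vertex k)) /\
      (forall (k : 'I_(chart_size c)) i, 0 <= vertex k i <= 1)].

(** What a set must satisfy in order to become the star of a vertex placed at
    [v] in a chart that refines all the charts [cs]. *)
Definition subordinate (cs : seq chart) (v : I -> R) (G : set X) :=
  [/\ open G, forall i, 0 <= v i <= 1, forall x, G x -> admissible x v &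
    forall c, c \in cs -> forall x0, G x0 ->
    exists k : 'I_(chart_size c), forall x, G x -> 0 < bump k x].

Lemma subordinate_nbhd (cs : seq chart) y x : A x -> f x = y ->
  (forall c, c \in cs -> valid_chart c /\ chart_dom c y) ->
  exists G, G x /\ subordinate cs (coord (g0 x)) G.
Proof.
move=> Ax fxy csP.
have [G [oG Gx GP]] : exists G, [/\ open G, G x & forall c, c \in cs ->
    exists k : 'I_(chart_size c), forall x, G x -> 0 < bump k x].
  elim: cs csP => [|c cs IHs] csP; first by exists setT; split => //; exact: openT.
  have [|G [oG Gx GP]] := IHs.
    by move=> c' c's; apply: csP; rewrite inE c's orbT.
  have [[_ [cb b0] [_ b1] _ _] cy] := csP c (mem_head _ _).
  have [k bk] : exists k : 'I_(chart_size c), 0 < bump k x.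
    apply: contrapT => nk; have := b1 x Ax; rewrite fxy => /(_ cy).
    rewrite big1 => [/esym/eqP|k _]; first by rewrite oner_eq0.
    apply/eqP; rewrite eq_le b0 andbT leNgt; apply/negP => bk.
    by apply: nk; exists k.
  exists (G `&` [set x' | 0 < bump k x']); split => //.
    apply: openI => //; apply: open_lt_fun; last exact: cb.
    exact: cst_continuous.
  move=> c'; rewrite inE => /predU1P[->|c's].
    by exists k => x' [].
  by have [k' k'P] := GP c' c's; exists k' => x' [Gx' _]; exact: k'P.
have nB : nbhs x [set x' | admissible x' (coord (g0 x))] := admissible_near x.
move: nB; rewrite nbhsE => -[B [oB Bx] BP].
exists (G `&` B); split => //; split.
- exact: openI.
- by move=> i; exact: coord_itv.
- by move=> x' [_]; exact: BP.
- by move=> c /GP[k kP] x0 _; exists k => x' [Gx' _]; exact: kP.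
Qed.

Lemma subordinate_sub (cs : seq chart) v (G G' : set X) : open G' -> G' `<=` G ->
  subordinate cs v G -> subordinate cs v G'.
Proof.
move=> oG' G'G [_ v01 av csP]; split => //; first by move=> x /G'G/av.
move=> c cc x0 /G'G Gx0; have [k kP] := csP c cc x0 Gx0.
by exists k => x /G'G/kP.
Qed.

(** Compactness of the fibre gives a finite subordinate cover, and the dimension
    of [f^-1 y] gives a refinement of order at most [n] there.  Its members are
    traces of open sets of [X], which are cut down to remain subordinate; the
    members that avoid [A] are replaced by the empty set. *)
Lemma subordinate_cover (cs : seq chart) y :
  (forall c, c \in cs -> valid_chart c /\ chart_dom c y) ->
  exists N (G : 'I_N -> set X) (v : 'I_N -> I -> R),
  [/\ forall k, subordinate cs (v k) (G k),
    forall x, A x -> f x = y -> exists k, G k x &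
    forall x, A x -> f x = y -> (#|[pred k | `[< G k x >]]| <= n.+1)%N].
Proof.
move=> csP; pose K := A `&` f @^-1` [set y].
have GxP (x : X) : exists G, subordinate cs (coord (g0 x)) G /\ (K x -> G x).
  have [Kx|nKx] := pselect (K x).
    have [Ax fxy] := Kx; have [G [Gx fG]] := subordinate_nbhd Ax fxy csP.
    by exists G.
  exists set0; split => //; split => //; first exact: open0.
  by move=> i; exact: coord_itv.
have [G0 G0P] := choice GxP.
have oG0 x : open (G0 x) by have [[]] := G0P x.
have [|s sK] := compact_finite_subcover (@fA_compact y) oG0.
  by move=> x Kx; exists x => //; have [_] := G0P x; apply.
pose T := set_type (f @^-1` [set y]).
pose U0 : set (set T) := [set (\val : T -> X) @^-1` B | B in
   [set G0 x | x in [set` s]] `|` [set ~` A]].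
have [||V [fV [oV cV] rV ordV]] := @fdim y U0.
- apply: finite_image; rewrite finite_setU; split => //.
  by apply: finite_image; exact: finite_seq.
- split.
    move=> _ [B BU <-]; exists B => //.
    by case: BU => [[x _ <-]//|->]; exact: closed_openC.
  rewrite -subTset => t _; have [At|nAt] := pselect (A (\val t)).
    have [|x xs Gxt] := sK (\val t); first by split => //; exact: set_valP.
    exists ((\val : T -> X) @^-1` G0 x) => //; exists (G0 x) => //.
    by left; exists x.
  by exists ((\val : T -> X) @^-1` (~` A)) => //; exists (~` A) => //; right.
have /finite_seqP[vs0 Vvs0] := fV.
pose vs := undup vs0; have Vvs : V = [set` vs].
  by rewrite Vvs0; apply/seteqP; split => B /=; rewrite mem_undup.
pose N := size vs; pose B (k : 'I_N) : set T := nth set0 vs k.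
have VB k : V (B k) by rewrite Vvs /=; exact: mem_nth.
have GvP (k : 'I_N) : exists Gv : set X * (I -> R), [/\ subordinate cs Gv.2 Gv.1,
    forall t : T, Gv.1 (\val t) -> B k t &
    forall t : T, A (\val t) -> B k t -> Gv.1 (\val t)].
  have [E oE EB] := oV _ (VB k).
  have [_ [D DU <-] BD] := rV _ (VB k).
  case: DU => [[x xs] GD|DA].
    exists (E `&` G0 x, coord (g0 x)); split => /=.
    - have [fG _] := G0P x; apply: subordinate_sub fG; last by move=> ? [].
      by apply: openI.
    - by move=> t [Et _]; rewrite -EB.
    - move=> t At Bt; split; first by rewrite -EB in Bt.
      by rewrite GD; exact: BD.
  exists (set0, fun=> 0); split => //=.
    by split => //=; [exact: open0|move=> i; rewrite lexx ler01].
  by move=> t At /BD; rewrite DA; apply.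
have [Gv GvH] := choice GvP.
exists N, (fun k => (Gv k).1), (fun k => (Gv k).2); split.
- by move=> k; have [] := GvH k.
- move=> x Ax fxy; pose t : T := exist _ x (mem_set fxy).
  have : (\bigcup_(A in V) A) t by rewrite cV.
  rewrite Vvs => -[D /= Dvs Dt].
  have kN : (index D vs < N)%N by rewrite index_mem.
  exists (Ordinal kN); have [_ _ H] := GvH (Ordinal kN).
  by apply: (H t) => //; rewrite /B /= nth_index.
- move=> x Ax fxy; pose t : T := exist _ x (mem_set fxy).
  rewrite -(@card_le_finpred _ [set k | (Gv k).1 x]).
  apply: card_le_trans (ordV t).
  rewrite -(card_le_eql (@inj_card_eq _ _ [set k | (Gv k).1 x] B _)).
    apply: subset_card_le => _ [k Gk <-]; split; first exact: VB.
    by have [_ H _] := GvH k; apply: H.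
  move=> k k' _ _ /eqP; rewrite /B nth_uniq ?undup_uniq//.
  by move=> /eqP/val_inj.
Qed.

(** Sums of bumps at finitely many points of the fibre, grouped by the members of
    the subordinate cover, exceed 1/2 in total along the fibre.  Truncation
    brings their order down to [n] on all of [X] without changing them on the
    fibre, and then they can be normalized where their sum exceeds 1/2, which
    happens on a whole tube around the fibre. *)
Lemma chart_at (cs : seq chart) y :
  (forall c, c \in cs -> valid_chart c /\ chart_dom c y) ->
  exists c, [/\ valid_chart c, chart_dom c y &
    forall c', c' \in cs -> chart_refines c c'].
Proof.
move=> csP; have [N [G [v [fG KG ordG]]]] := subordinate_cover csP.
pose K := A `&` f @^-1` [set y].
have oG k : open (G k) by have [] := fG k.
have qxP (x : X) : exists q : 'I_N -> X -> R, [/\ forall k, continuous (q k),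
    forall k z, 0 <= q k z, forall k z, 0 < q k z -> G k z &
    K x -> exists k, q k x = 1].
  have [Kx|nKx] := pselect (K x); last first.
    exists (fun _ _ => 0); split => //; first by move=> k; exact: cst_continuous.
    by move=> k z; rewrite ltxx.
  have [k0 Gx] := KG x Kx.1 Kx.2.
  have [u [cu u01 ux uG]] := paracompact_point_urysohn R pX (oG k0) Gx.
  exists (fun k => if k == k0 then u else fun=> 0); split.
  - by move=> k; case: eqP => _ //; exact: cst_continuous.
  - by move=> k z; case: eqP => _ //; have /andP[] := u01 z.
  - by move=> k z; case: eqP => [->|_]; [exact: uG|rewrite ltxx].
  - by move=> _; exists k0; rewrite eqxx.
have [qx qxH] := choice qxP.
have cqx x k : continuous (qx x k) by have [+ _ _ _] := qxH x; exact.
have qx0 x k z : 0 <= qx x k z by have [_ + _ _] := qxH x; exact.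
have qxG x k z : 0 < qx x k z -> G k z by have [_ _ + _] := qxH x; exact.
have [||s sK] := @compact_finite_subcover _ _ _
    (fun x => [set z | 1 / 2 < \sum_(k <- enum 'I_N) qx x k z]) (@fA_compact y).
- move=> x; apply: open_lt_fun; first exact: cst_continuous.
  exact: continuous_sum.
- move=> x Kx; exists x => //=; have [_ _ _ /(_ Kx)[k qk]] := qxH x.
  apply: lt_le_trans (_ : qx x k x <= _); first by rewrite qk; lra.
  by rewrite (bigD1_seq k) ?mem_enum ?enum_uniq//= lerDl sumr_ge0.
pose q k z := \sum_(x <- s) qx x k z.
have cq k : continuous (q k) by exact: continuous_sum.
have q0 k z : 0 <= q k z by exact: sumr_ge0.
have qG k z : 0 < q k z -> G k z.
  apply: contraPP => nG; rewrite /q big1 ?ltxx// => x _.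
  apply/eqP; rewrite eq_le qx0 andbT leNgt; apply/negP => /qxG; exact: nG.
have [r [cr r0 rq ordr req]] := truncate_order n.+1 cq q0.
pose S z := \sum_(k <- enum 'I_N) r k z.
have S0 z : 0 <= S z by exact: sumr_ge0.
have cS : continuous S by exact: continuous_sum.
pose M z := Num.max (S z) (1 / 2).
have M0 z : 0 < M z by rewrite lt_max; apply/orP; right; lra.
have cM : continuous M.
  by move=> z; apply: continuous_max; [exact: cS|exact: cst_continuous].
pose p k z := r k z / M z.
have sump z : \sum_(k < N) p k z = S z / M z.
  by rewrite -mulr_suml /S big_enum.
have [||V [oV Vy VS]] := @fiber_tube y [set z | 1 / 2 < S z].
- by apply: open_lt_fun => //; exact: cst_continuous.
- move=> x [Ax fxy] /=.
  have -> : S x = \sum_(k <- enum 'I_N) q k x.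
    apply: eq_bigr => k _; apply: req; apply: leq_trans (ordG x Ax fxy).
    apply: subset_leq_card; apply/fintype.subsetP => k'; rewrite !inE => /qG Gx.
    exact/asboolP.
  have [|x0 x0s /= h] := sK x; first by split.
  apply: lt_le_trans h _; apply: ler_sum => k _; rewrite /q.
  by rewrite (big_rem x0)//= lerDl sumr_ge0.
have rp k z : (0 < p k z) = (0 < r k z) by rewrite pmulr_lgt0// invr_gt0.
exists (@Chart R I X Y V N p v); split => //=; first split => //=.
- split=> k; last by move=> z; rewrite divr_ge0// ltW.
  by move=> z; apply: cvgM; [exact: cr|apply: cvgV; [rewrite gt_eqF|exact: cM]].
- split=> [z|z Az Vz]; rewrite sump.
    by rewrite ler_pdivrMr// mul1r le_max lexx.
  rewrite /M (max_idPl _) ?divff//.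
    by rewrite gt_eqF//; apply: lt_trans (VS _ (conj Az Vz)); lra.
  by apply/ltW/VS.
- move=> z; apply: leq_trans (ordr z); apply: subset_leq_card.
  by apply/fintype.subsetP => k; rewrite !inE rp.
- split=> [k z|k i]; last by have [_ + _ _] := fG k; exact.
  by rewrite rp => /rq/qG; have [_ _ + _] := fG k; exact.
- move=> c' c's k x0 /=; rewrite rp => /rq/qG Gx0.
  have [_ _ _ /(_ c' c's x0 Gx0)[k' k'P]] := fG k.
  by exists k' => x; rewrite rp => /rq/qG/k'P.
Qed.

(** The closures matter: a point in the closure of [p.1] is in the domain of the
    chart, hence a chart refining it exists there, while around any other point
    there is a neighbourhood that [p.1] does not meet. *)
Definition good_level (L : set (set Y * chart)) :=
  (forall p, L p -> [/\ open p.1, closure p.1 `<=` chart_dom p.2 &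
     valid_chart p.2]) /\
  (forall y : Y, exists M, [/\ open M, M y &
     finite_set [set p | L p /\ p.1 `&` M !=set0]]).

Lemma good_levelU L L' : good_level L -> good_level L' -> good_level (L `|` L').
Proof.
move=> [vL fL] [vL' fL']; split; first by move=> p [/vL|/vL'].
move=> y; have [M [oM My fM]] := fL y; have [M' [oM' M'y fM']] := fL' y.
exists (M `&` M'); split => //; first exact: openI.
apply: (@sub_finite_set _ _ ([set p | L p /\ p.1 `&` M !=set0] `|`
  [set p | L' p /\ p.1 `&` M' !=set0])); last by rewrite finite_setU.
by move=> p [[Lp|Lp] [z [pz [Mz M'z]]]]; [left|right]; split => //; exists z.
Qed.

(** Local finiteness leaves finitely many earlier charts to be refined around a
    point.  Hence all the levels can be chosen before property C is applied,
    without knowing which members of their covers it will select. *)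
Lemma next_level (H : set (set Y * chart)) : good_level H ->
  exists L, [/\ good_level L, \bigcup_(p in L) p.1 = setT &
    forall p h, L p -> H h -> p.1 `&` h.1 !=set0 -> chart_refines p.2 h.2].
Proof.
move=> [vH fH].
have cyP (y : Y) : exists c, [/\ valid_chart c, chart_dom c y &
    exists M, [/\ open M, M y & forall h, H h -> h.1 `&` M !=set0 ->
      chart_refines c h.2]].
  have [M [oM My fM]] := fH y.
  (* Earlier charts that come near [y] without containing it in their closure
     are avoided; the chart at [y] is made to refine the others. *)
  pose away := [set h : set Y * chart | (H h /\ h.1 `&` M !=set0) /\ ~ closure h.1 y].
  have caway : closed (\bigcup_(h in away) closure h.1).
    apply: closed_bigcup; last by move=> h _; exact: closed_closure.
    by apply: sub_finite_set fM => h [].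
  pose touching := [set h : set Y * chart | (H h /\ h.1 `&` M !=set0) /\ closure h.1 y].
  have /finite_seqP[hs hsE] : finite_set touching by apply: sub_finite_set fM => h [].
  have [|c [vc cy crefl]] := @chart_at [seq h.2 | h <- hs] y.
    move=> c /mapP[h hhs ->].
    have : touching h by rewrite hsE.
    by move=> [[/vH[_ hd' vh] _] /hd'].
  exists c; split => //; exists (M `&` ~` \bigcup_(h in away) closure h.1); split.
  - by apply: openI => //; exact: closed_openC.
  - by split => // -[h [_ +]].
  - move=> h Hh [z [hz [Mz naz]]]; apply: crefl; apply: map_f.
    suff : touching h by rewrite hsE.
    have hM : h.1 `&` M !=set0 by exists z.
    split => //; apply: contrapT => nh; apply: naz; exists h => //.
    exact: subset_closure.
have [c cH] := choice cyP.
have NP (y : Y) : exists N, [/\ open N, N y & closure N `<=` chart_dom (c y) /\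
    forall h, H h -> h.1 `&` N !=set0 -> chart_refines (c y) h.2].
  have [[odom _ _ _ _] cy [M [oM My MH]]] := cH y.
  have [||N [oN Ny clN]] := @paracompact_regular _ y (chart_dom (c y) `&` M) pY.
  - exact: openI.
  - by split.
  - exists N; split => //; split; first by move=> z /clN[].
    move=> h Hh [z [hz Nz]]; apply: MH => //; exists z; split => //.
    by have [] := clN z (subset_closure Nz).
have [N NH] := choice NP.
have [|V [[oV cV] rV lfV]] := (proj2 pY) (range N).
  split; first by move=> _ [y _ <-]; have [] := NH y.
  rewrite -subTset => y _; exists (N y); first by exists y.
  by have [] := NH y.
have cBP B : exists cB, V B -> [/\ closure B `<=` chart_dom cB, valid_chart cB &
    forall h, H h -> B `&` h.1 !=set0 -> chart_refines cB h.2].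
  have [VB|nVB] := pselect (V B); last by exists void_chart.
  have [_ [y _ <-] BN] := rV _ VB; have [_ _ [clN Nrefl]] := NH y.
  have [vc _ _] := cH y; exists (c y) => _; split => //.
    exact: subset_trans (closureS BN) clN.
  by move=> h Hh [z [Bz hz]]; apply: Nrefl => //; exists z; split => //; exact: BN.
have [cB cBH] := choice cBP.
exists [set (B, cB B) | B in V]; split.
- split; first by move=> _ [B VB <-] /=; have [] := cBH B VB; split => //; exact: oV.
  move=> y; have [M nM fM] := lfV y.
  exists M^°; split; [exact: open_interior|exact: nM|].
  apply: (@sub_finite_set _ _ ((fun B => (B, cB B)) @`
      [set B | V B /\ B `&` M !=set0])); last exact: finite_image.
  move=> _ [[B VB <-] [z [Bz Mz]]]; exists B => //; split => //; exists z.
  by split => //; exact: interior_subset.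
- rewrite -subTset => z _; have : (\bigcup_(B in V) B) z by rewrite cV.
  by move=> [B VB Bz]; exists (B, cB B) => //; exists B.
- by move=> _ h [B VB <-] Hh /= Bh; have [_ _] := cBH B VB; exact.
Qed.

Lemma refining_levels : exists L : nat -> set (set Y * chart),
  [/\ forall k, good_level (L k), forall k, \bigcup_(p in L k) p.1 = setT &
    forall k l p h, (l < k)%N -> L k p -> L l h -> p.1 `&` h.1 !=set0 ->
      chart_refines p.2 h.2].
Proof.
have nextP (H : set (set Y * chart)) : exists L, good_level H ->
    [/\ good_level L, \bigcup_(p in L) p.1 = setT &
    forall p h, L p -> H h -> p.1 `&` h.1 !=set0 -> chart_refines p.2 h.2].
  have [gH|nH] := pselect (good_level H); last by exists set0.
  by have [L] := next_level gH; exists L.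
have [next nextH] := choice nextP.
pose H := fix H k : set (set Y * chart) :=
  if k is k'.+1 then H k' `|` next (H k') else set0.
have gH k : good_level (H k).
  elim: k => [|k gHk]; last first.
    by apply: good_levelU => //; have [] := nextH _ gHk.
  split=> // y; exists setT; split => //; first exact: openT.
  by apply: (@sub_finite_set _ _ set0) => [p [[]]|]; exact: finite_set0.
have HL k l : (l < k)%N -> next (H l) `<=` H k.
  elim: k => // k IHk; rewrite ltnS leq_eqVlt => /predU1P[->|/IHk h] p Lp.
    by right.
  by left; exact: h.
exists (fun k => next (H k)); split.
- by move=> k; have [] := nextH _ (gH k).
- by move=> k; have [] := nextH _ (gH k).
- move=> k l p h lk Lp Lh; have [_ _ r] := nextH _ (gH k).
  by apply: r => //; exact: HL Lh.
Qed.

(** Property C turns the cover of level [k] into a disjoint family [gam k], so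
    that at most one chart of each level is active at a point; the bumps are
    subordinate to the unions of the [gam k]. *)
Lemma blend_data : exists (phi : nat -> Y -> R) (ch : nat -> Y -> chart),
  [/\ forall k, continuous (phi k), forall k y, 0 <= phi k y <= 1,
    (forall y, exists k, phi k y = 1) /\
    (forall y : Y, exists M, \forall z \near y, forall k, (M <= k)%N -> phi k z = 0),
    (forall k y, valid_chart (ch k y)) /\
    (forall k y, 0 < phi k y -> chart_dom (ch k y) y) &
    (forall k y, 0 < phi k y -> \forall z \near y, ch k z = ch k y) /\
    (forall k l y, (l < k)%N -> 0 < phi k y -> 0 < phi l y ->
      chart_refines (ch k y) (ch l y))].
Proof.
have [L [gL cL rL]] := refining_levels.
pose w k := [set p.1 | p in L k].
have [|gam [gamP cgam]] := hC (w := w).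
  move=> k; split; first by move=> _ [p /(proj1 (gL k))[+ _ _] <-].
  by rewrite bigcup_image.
pose W k := \bigcup_(B in gam k) B.
have [||phi [cphi phi01 phiW phi1 lfphi]] := @paracompact_bumps R _ W pY.
- by move=> k; apply: bigcup_open => B; have [+ _ _] := gamP k; apply.
- exact: cgam.
have pP (kB : nat * set Y) : exists p, gam kB.1 kB.2 -> L kB.1 p /\ kB.2 `<=` p.1.
  case: kB => k B /=; have [gB|nB] := pselect (gam k B); last first.
    by exists (set0, void_chart).
  by have [_ _ /(_ _ gB)[_ [p Lp <-] Bp]] := gamP k; exists p.
have [p pH] := choice pP.
have BP (ky : nat * Y) : exists B, W ky.1 ky.2 -> gam ky.1 B /\ B ky.2.
  have [[B gB By]|nW] := pselect (W ky.1 ky.2); last by exists set0.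
  by exists B.
have [B BH] := choice BP.
pose ch k y := if `[< W k y >] then (p (k, B (k, y))).2 else void_chart.
have chE k y : W k y -> L k (p (k, B (k, y))) /\ (p (k, B (k, y))).1 y.
  move=> Wy; have [gB By] := BH (k, y) Wy; have [Lp Bp] := pH (k, _) gB.
  by split=> //; exact: Bp.
exists phi, ch; split => //; split.
- move=> k y; rewrite /ch; case: asboolP => [Wy|_].
    by have [Lp _] := chE k y Wy; have [] := (proj1 (gL k)) _ Lp.
  split => //=; first exact: open0.
  + by split; [case|case].
  + by split => [x|//]; rewrite big_ord0 ler01.
  + by move=> x; rewrite (leq_trans (max_card _))// card_ord.
  + by split; case.
- move=> k y /phiW Wy; rewrite /ch; case: asboolP => [_|//].
  have [Lp py] := chE k y Wy; have [_ cp _] := (proj1 (gL k)) _ Lp.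
  exact/cp/subset_closure.
- move=> k y /phiW Wy; have [gB By] := BH (k, y) Wy.
  have [og tg _] := gamP k.
  apply: filterS (open_nbhs_nbhs (conj (og _ gB) By)) => z Bz.
  have Wz : W k z by exists (B (k, y)).
  have [gBz Bzz] := BH (k, z) Wz.
  have BB : B (k, z) = B (k, y).
    by apply: (tg _ _ gBz gB); exists z.
  by rewrite /ch; case: asboolP => // _; case: asboolP => // _; rewrite BB.
- move=> k l y lk /phiW Wk /phiW Wl; rewrite /ch.
  case: asboolP => // _; case: asboolP => // _.
  have [Lk py] := chE k y Wk; have [Ll py'] := chE l y Wl.
  by apply: rL Lk Ll _ => //; exists y.
Qed.

(** * The blended map and its fibre images *)

Section BlendProperties.
Variables (phi : nat -> Y -> R) (ch : nat -> Y -> chart).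
Hypotheses (cphi : forall k, continuous (phi k)).
Hypotheses (phi01 : forall k y, 0 <= phi k y <= 1).
Hypotheses (chV : forall k y, valid_chart (ch k y)).
Hypotheses (chdom : forall k y, 0 < phi k y -> chart_dom (ch k y) y).
Hypotheses (chloc : forall k y, 0 < phi k y -> \forall z \near y, ch k z = ch k y).
Hypotheses (chref : forall k l y, (l < k)%N -> 0 < phi k y -> 0 < phi l y ->
  chart_refines (ch k y) (ch l y)).

Local Notation V := (expected phi ch).
Local Notation B := (blend phi ch f (fun x => coord (g0 x))).

Lemma unit_valued_norm (u : I -> R) i : unit_valued u -> `|u i| <= 1.
Proof. by move=> /(_ i)/andP[u0 u1]; rewrite ger0_norm. Qed.

Lemma elt_unit_valued k y (j : 'I_(chart_size (ch k y))) : unit_valued (chart_elt j).2.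
Proof. by have [_ _ _ _ [_ v01]] := chV k y; exact: v01. Qed.

Lemma descend_unit_valued k y s : unit_valued s.2 -> unit_valued (descend (ch k y) s).2.
Proof.
move=> us; have [->//|[j ->]] := descend_elt (ch k y) s.
exact: elt_unit_valued.
Qed.

Lemma expected_unit_valued i y s : unit_valued s.2 -> unit_valued (V i y s).
Proof.
apply: (@expected_ind _ _ _ _ phi ch i y (@unit_valued R I)
  [set s | unit_valued s.2]) => //; first exact: unit_valued_convex.
by move=> l s'; exact: descend_unit_valued.
Qed.

Lemma expected_continuous i s a : unit_valued s.2 -> continuous (fun y => V i y s a).
Proof.
elim: i s => [|i IHi] s us /=; first exact: cst_continuous.
move=> y; apply: (@continuousD _ _ _ (fun y => (1 - phi i y) * V i y s a)
  (fun y => phi i y * V i y (descend (ch i y) s) a)).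
  apply: cvgM; last exact: (IHi s us).
  by apply: cvgB; [exact: cst_continuous|exact: cphi].
apply: bump_mul_continuous.
- exact: cphi.
- by move=> z; exact/unit_valued_norm/expected_unit_valued/descend_unit_valued.
- move=> z phiz; have {}phiz : 0 < phi i z.
    by rewrite lt_neqAle eq_sym phiz; have /andP[] := phi01 i z.
  apply: (@near_eq_continuous_at _ _ _ _ (fun z' => V i z' (descend (ch i z) s) a)).
    by apply: filterS (chloc phiz) => z' ->.
  exact/IHi/descend_unit_valued.
Qed.

(** A convex set that contains [g0 x] and the expected positions from all the
    vertices whose star contains [x] contains the blended image of
    [x]. *)
Lemma blend_ind i x (P : (I -> R) -> Prop) : convex_pred P ->
  P (coord (g0 x)) ->
  (forall l (k : 'I_(chart_size (ch l (f x)))), 0 < bump k x ->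
     P (V l (f x) (chart_elt k))) -> P (B i x).
Proof.
move=> cP P0 PV; elim: i => [//|i IHi] /=.
have [_ [_ b0] [b1 _] _ _] := chV i (f x).
apply: (cP) => //; apply: convex_pred_rest => //.
- by move=> k bk; exact: PV.
Qed.

Lemma blend_unit_valued i x : unit_valued (B i x).
Proof.
apply: blend_ind; [exact: unit_valued_convex|exact: coord_itv|].
by move=> l k _; apply: expected_unit_valued; exact: elt_unit_valued.
Qed.

Lemma blend_admissible i x : admissible x (B i x).
Proof.
apply: blend_ind; [exact: admissible_convex|exact: admissible_refl|].
move=> l k bk.
apply: (@expected_ind _ _ _ _ phi ch l (f x) (admissible x)
  [set s | s.1 x /\ admissible x s.2]) => //.
- exact: admissible_convex.
- by move=> s [].
- move=> l' s [sx as_]; split; first exact: descend_sub.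
  have : (descend (ch l' (f x)) s).1 x by exact: descend_sub.
  have [->//|[k' ->]] := descend_elt (ch l' (f x)) s.
  by have [_ _ _ _ [adm _]] := chV l' (f x); exact: adm.
- by split => //; have [_ _ _ _ [adm _]] := chV l (f x); exact: adm.
Qed.

Lemma g0_coord_continuous a : continuous (fun x => coord (g0 x) a).
Proof.
move=> x; apply: (@continuous_comp _ _ _ g0 (fun q => coord q a)); first exact: cg0.
exact: coord_continuous.
Qed.

(** The chart active at level [i] jumps, but only where [phi i] vanishes. *)
Lemma blend_continuous i a : continuous (fun x => B i x a).
Proof.
elim: i => [|i IHi] /=.
  exact: g0_coord_continuous.
pose psi x := phi i (f x).
have cpsi : continuous psi.
  by move=> x; apply: (@continuous_comp _ _ _ f (phi i)); [exact: cf|exact: cphi].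
pose h x := \sum_(k < chart_size (ch i (f x)))
        bump k x * V i (f x) (chart_elt k) a +
      (1 - \sum_(k < chart_size (ch i (f x))) bump k x) * coord (g0 x) a.
move=> x; apply: (@continuousD _ _ _ (fun x => (1 - psi x) * B i x a)
  (fun x => psi x * h x)).
  apply: cvgM; last exact: IHi.
  by apply: cvgB; [exact: cst_continuous|exact: cpsi].
apply: bump_mul_continuous; first exact: cpsi.
  move=> z; have : unit_valued (fun a => \sum_(k < chart_size (ch i (f z)))
        bump k z * V i (f z) (chart_elt k) a +
      (1 - \sum_(k < chart_size (ch i (f z))) bump k z) * coord (g0 z) a).
    have [_ [_ b0] [b1 _] _ _] := chV i (f z).
    apply: (@convex_pred_rest R I _ (@unit_valued R I)
      (index_enum 'I_(chart_size (ch i (f z))))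
      (fun k => bump k z) (fun k => V i (f z) (chart_elt k)) (coord (g0 z))) => //.
    - exact: unit_valued_convex.
    - by move=> k _; apply: expected_unit_valued; exact: elt_unit_valued.
        - exact: coord_itv.
  by move=> /unit_valued_norm; exact.
move=> z psiz; have {}psiz : 0 < phi i (f z).
  by rewrite lt_neqAle eq_sym psiz; have /andP[] := phi01 i (f z).
set c := ch i (f z).
apply: (@near_eq_continuous_at _ _ _ _ (fun z' => \sum_(k < chart_size c)
        bump k z' * V i (f z') (chart_elt k) a +
      (1 - \sum_(k < chart_size c) bump k z') * coord (g0 z') a)).
  have nz : nbhs z [set z' | ch i (f z') = c] := @cf z _ (chloc psiz).
  apply: filterS nz => z' /= chz'.
  by rewrite /h chz'.
have [_ [cb _] _ _ _] := chV i (f z).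
apply: cvgD.
  apply: (@continuous_sum R X _ _ (fun k z' => bump k z' * V i (f z') (chart_elt k) a)).
  move=> k z'; apply: cvgM; first exact: cb.
  apply: (@continuous_comp _ _ _ f (fun y => V i y (chart_elt k) a)).
    exact: cf.
  by apply: expected_continuous; exact: elt_unit_valued.
apply: cvgM.
  by apply: cvgB; [exact: cst_continuous|apply: continuous_sum].
exact: g0_coord_continuous.
Qed.

Section Fiber.
Variables (t : nat) (x : X).
Hypotheses (phit : phi t (f x) = 1) (Ax : A x).

(** Membership in the simplex spanned by the expected positions from those
    vertices of the chart of level [t] whose star contains [x]. *)
Definition simplex_at (u : I -> R) := forall P, convex_pred P ->
  (forall k : 'I_(chart_size (ch t (f x))), 0 < bump k x ->
     P (V t (f x) (chart_elt k))) -> P u.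

Lemma simplex_at_convex : convex_pred simplex_at.
Proof.
by move=> r u v r01 uS vS P cP PV; apply: (cP) => //; [exact: uS|exact: vS].
Qed.

(** Since [phi t = 1], the walk moves at level [t] with certainty.  Whatever
    moves come before, the star of the current state contains [x] and the
    state is a vertex of a chart that refines the one of level [t]; so the
    walk reaches a vertex of the latter whose star contains [x]. *)
Lemma expected_simplex i l (k : 'I_(chart_size (ch l (f x)))) :
  (t < i)%N -> (t < l)%N -> 0 < phi l (f x) -> 0 < bump k x ->
  simplex_at (V i (f x) (chart_elt k)).
Proof.
elim: i l k => // i IHi l k; rewrite ltnS leq_eqVlt => /predU1P[<-|ti] tl phil bk /=.
  have [||k' k'E k'x] := @descend_refined _ _ _ _ (ch l (f x)) (ch t (f x)) k x.
  - by apply: chref => //; rewrite phit.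
  - by [].
  rewrite phit k'E => P _ PV.
  rewrite (_ : (fun a => _) = V t (f x) (chart_elt k')); first exact: PV.
  by apply/funext => a; rewrite subrr mul0r add0r mul1r.
have [phii|phii] := eqVneq (phi i (f x)) 0.
  rewrite (_ : (fun a => _) = V i (f x) (chart_elt k)); first exact: (IHi l).
  by apply/funext => a; rewrite phii subr0 mul1r mul0r addr0.
have {}phii : 0 < phi i (f x).
  by rewrite lt_neqAle eq_sym phii; have /andP[] := phi01 i (f x).
apply: simplex_at_convex => //; first exact: (IHi l).
have : (descend (ch i (f x)) (chart_elt k)).1 x by exact: descend_sub.
have [->_|[k' ->] k'x] := descend_elt (ch i (f x)) (chart_elt k).
  exact: (IHi l).
exact: (IHi i).
Qed.

(** The simplex depends on [x] only through the set of vertices of level [t]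
    whose star contains [x], and there are at most [n + 1] of these.  Thus the
    image of the fibre lies in finitely many simplices of dimension at most
    [n]. *)
Lemma blend_simplex i : (t < i)%N -> simplex_at (B i x).
Proof.
elim: i => // i IHi; rewrite ltnS leq_eqVlt => /predU1P[ti|ti] /=.
  rewrite -ti phit.
  have [_ [_ b0] [_ b1] _ _] := chV t (f x).
  have s1 : \sum_(k < chart_size (ch t (f x))) bump k x = 1.
    by apply: b1 => //; apply: chdom; rewrite phit.
  rewrite s1 => P cP PV.
  rewrite (_ : (fun a => _) = (fun a => \sum_(k < chart_size (ch t (f x)))
    bump k x * V t (f x) (chart_elt k) a)).
    exact: convex_pred_bary.
  by apply/funext => a; rewrite subrr !mul0r add0r addr0 mul1r.
have [phii|phii] := eqVneq (phi i (f x)) 0.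
  rewrite (_ : (fun a => _) = B i x); first exact: IHi.
  by apply/funext => a; rewrite phii subr0 mul1r mul0r addr0.
have {}phii : 0 < phi i (f x).
  by rewrite lt_neqAle eq_sym phii; have /andP[] := phi01 i (f x).
apply: simplex_at_convex => //; first exact: IHi.
have [_ [_ b0] [_ b1] _ _] := chV i (f x).
have s1 : \sum_(k < chart_size (ch i (f x))) bump k x = 1.
  by apply: b1 => //; exact: chdom.
rewrite s1 (_ : (fun a => _) = (fun a => \sum_(k < chart_size (ch i (f x)))
    bump k x * V i (f x) (chart_elt k) a)); last first.
  by apply/funext => a; rewrite subrr mul0r addr0.
apply: convex_pred_bary => //; first exact: simplex_at_convex.
by move=> k bk; exact: expected_simplex.
Qed.

End Fiber.

(** Only finitely many levels are active near a point, which makes the limit of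
    the blended maps locally equal to one of them. *)
Lemma blend_stable M i x : (forall k, (M <= k)%N -> phi k (f x) = 0) ->
  (M <= i)%N -> B i x = B M x.
Proof.
move=> phiM; elim: i => [|i IHi]; first by rewrite leqn0 => /eqP ->.
rewrite leq_eqVlt => /predU1P[->//|]; rewrite ltnS => Mi /=.
apply/funext => a; rewrite phiM// subr0 mul1r mul0r addr0.
by rewrite IHi.
Qed.

End BlendProperties.

(** The limit of the blended maps: it is continuous and close to [g0], and it
    maps each fibre into finitely many [n]-simplices. *)
Lemma fiberwise_small_approx (j : nat) : exists g : X -> Q,
  [/\ continuous g, forall x, d (g0 x) (g x) <= alpha x &
    forall y, small_cover j n (g @` (A `&` f @^-1` [set y]))].
Proof.
have [phi [ch [cphi phi01 [phi1 lfphi] [chV chdom] [chloc chref]]]] := blend_data.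
have [M MH] := choice lfphi.
pose B := blend phi ch f (fun x => coord (g0 x)).
have gP x : exists q, coord q = B (M (f x)) x.
  by apply: coord_surj; exact: blend_unit_valued.
have [g gH] := choice gP.
have gB i x : (M (f x) <= i)%N -> coord (g x) = B i x.
  move=> Mi; rewrite gH; apply/esym/blend_stable => // k.
  by move: k; exact: (nbhs_singleton (MH (f x))).
exists g; split.
- apply: cube_map_continuous => a x.
  apply: (@near_eq_continuous_at _ _ _ _ (fun z => B (M (f x)) z a)); last first.
    exact: blend_continuous.
  have nx : nbhs x [set z | forall k, (M (f x) <= k)%N -> phi k (f z) = 0].
    exact: (@cf x _ (MH (f x))).
  apply: filterS nx => z /= Mz.
  rewrite (gB (maxn (M (f z)) (M (f x)))) ?leq_maxl// /B.
  by rewrite (@blend_stable phi ch _ _ _ Mz) ?leq_maxr.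
- by move=> x; apply: admissible_close; rewrite gH; exact: blend_admissible.
- move=> y; have [t phit] := phi1 y.
  pose W (k : 'I_(chart_size (ch t y))) := expected phi ch t y (chart_elt k).
  have [F [oF tF sF cF]] := simplices_small_cover n j W.
  exists F; split => // _ [x [Ax fxy] <-]; apply: cF.
  have sx : simplex_at phi ch t x (coord (g x)).
    rewrite (gB (maxn t.+1 (M (f x)))) ?leq_maxr//.
    apply: blend_simplex => //; first by rewrite fxy.
    exact: leq_maxl.
  rewrite /simplex_at fxy in sx.
  exists [set k : 'I_(chart_size (ch t y)) | 0 < bump k x]%SET; split.
    by rewrite cardsE; have [_ _ _ + _] := chV t y; exact.
  by move=> P cP PW; apply: sx => // k bk; apply: PW; rewrite inE.
Qed.

End Density.

(** * Maps with small fibre images form an open set *)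

(** The maximum over [k] of [phi k * 2^-k] for bumps [phi k] subordinate to the
    [W k]. *)
Lemma positive_minorant (R : realType) (Y : topologicalType) (W : nat -> set Y) :
  paracompact Y -> (forall k, open (W k)) -> \bigcup_k W k = setT ->
  exists a : Y -> R, [/\ continuous a, forall y, 0 < a y &
    forall y, exists2 k, W k y & a y <= 2^-1 ^+ k].
Proof.
move=> pY oW cW.
have [phi [cphi phi01 phiW phi1 lfphi]] := paracompact_bumps R pY oW cW.
have [M MH] := choice lfphi.
pose mx := fix mx i (y : Y) : R :=
  if i is i'.+1 then Num.max (mx i' y) (phi i' y * 2^-1 ^+ i') else 0.
have cmx i : continuous (mx i).
  elim: i => [|i IHi] /=; first exact: cst_continuous.
  move=> y; apply: (@continuous_max _ _ (mx i) (fun y => phi i y * 2^-1 ^+ i)).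
    exact: IHi.
  by apply: cvgMl; exact: cphi.
have e0 i : 0 < 2^-1 ^+ i :> R by rewrite exprn_gt0.
have mx_ge0 i y : 0 <= mx i y.
  case: i => //= i; have /andP[p0 _] := phi01 i y.
  by rewrite le_max (mulr_ge0 p0 (ltW (e0 i))) orbT.
have mxE M0 z i : (forall k, (M0 <= k)%N -> phi k z = 0) -> (M0 <= i)%N ->
    mx i z = mx M0 z.
  move=> phiz; elim: i => [|i IHi]; first by rewrite leqn0 => /eqP ->.
  rewrite leq_eqVlt => /predU1P[->//|]; rewrite ltnS => Mi /=.
  by rewrite phiz// mul0r IHi//; exact/max_idPl.
have mxP i y : 0 < mx i y -> exists2 k, W k y & mx i y <= 2^-1 ^+ k.
  elim: i => [|i IHi] /=; first by rewrite ltxx.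
  have [h|h] := leP (mx i y) (phi i y * 2^-1 ^+ i); last exact: IHi.
  rewrite pmulr_lgt0// => phiy; exists i; first exact: phiW.
  by rewrite (ler_piMl (ltW (e0 i)))//; have /andP[] := phi01 i y.
have mx_ge k i y : (k < i)%N -> phi k y * 2^-1 ^+ k <= mx i y.
  elim: i => // i IHi; rewrite ltnS leq_eqVlt => /predU1P[->|/IHi h] /=.
    by rewrite le_max lexx orbT.
  by rewrite le_max h.
have mx0 y : 0 < mx (M y) y.
  have [k phik] := phi1 y; have kM : (k < M y)%N.
    rewrite ltnNge; apply/negP => /(nbhs_singleton (MH y)); rewrite phik.
    by move/eqP; rewrite oner_eq0.
  by apply: lt_le_trans (mx_ge k _ y kM); rewrite phik mul1r.
exists (fun y => mx (M y) y); split => //; last by move=> y; exact: mxP.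
move=> y; apply: (@near_eq_continuous_at _ _ _ _ (mx (M y))); last exact: cmx.
apply: filterS (MH y) => z phiz.
rewrite -(mxE _ z (maxn (M z) (M y)) (nbhs_singleton (MH z))) ?leq_maxl//.
by rewrite (mxE _ z _ phiz) ?leq_maxr.
Qed.

Section Openness.
Context {R : realType} {m : option nat} {X Y : topologicalType}.
Local Notation Q := (cube R m).
Variables (d : Q -> Q -> R) (n j : nat) (f : X -> Y) (A : set X).
Hypotheses (hd : compatible_metric d) (pY : paracompact Y) (cf : continuous f).
Hypotheses (fA_closed : forall C, closed C -> closed (f @` (A `&` C))).
Hypotheses (fA_compact : forall y, compact (A `&` f @^-1` [set y])).

(** Taking interiors keeps the margin [2^-k] valid on a neighbourhood of [K], as
    needed for passing to nearby fibres. *)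
Lemma compact_margin (g : X -> Q) (K : set X) (W : set Q) : continuous g ->
  compact K -> open W -> g @` K `<=` W ->
  exists k, K `<=` [set x | forall q, d (g x) q <= 2^-1 ^+ k -> W q]^°.
Proof.
move=> cg /compact_near_coveringP cK oW KW.
have [k _ kH] : \forall k \near \oo,
    K `<=` [set x | forall q, d (g x) q <= 2^-1 ^+ k -> W q]^°; last first.
  by exists k; exact: (kH k (leqnn k)).
apply: cK => x Kx.
have nW : nbhs (g x) W by apply: open_nbhs_nbhs; split => //; apply: KW; exists x.
have [e e0 eW] := proj1 (cmetric_nbhs hd (g x) W) nW.
have e2 : 0 < e / 2 by rewrite divr_gt0.
have nS : nbhs x [set x' | d (g x) (g x') < e / 2].
  exact: (cg x _ (cmetric_near hd (g x) e2)).
near=> x' k => /=.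
have nS' : nbhs x' [set x' | d (g x) (g x') < e / 2].
  by near: x'; exact: nbhs_interior nS.
apply: filterS nS' => x'' /= xx'' q qk; apply: eW => /=.
have : 2^-1 ^+ k < e / 2 by near: k; exact: exp2V_lt.
have := cmetric_triangle hd (g x) (g x'') q; lra.
Unshelve. all: by end_near. Qed.

Lemma small_cover_sub (C C' : set Q) : C `<=` C' -> small_cover j n C' ->
  small_cover j n C.
Proof.
move=> CC' [B [oB tB sB C'B]]; exists B; split => //.
exact: subset_trans CC' C'B.
Qed.

Lemma small_cover_open (C : set Q) : small_cover j n C ->
  exists W, [/\ open W, C `<=` W & small_cover j n W].
Proof.
move=> [B [oB tB sB CB]]; exists (\bigcup_a \bigcup_(U in B a) U); split => //.
  by apply: bigcup_open => a _; apply: bigcup_open => U /oB.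
by exists B; split.
Qed.

Definition fiberwise_small : set (continuousType X Q) :=
  [set g | forall y, small_cover j n (g @` (A `&` f @^-1` [set y]))].

(** The cover of the image of one fibre covers, with a margin, the images of the
    neighbouring fibres, and paracompactness of [Y] makes the margins into a
    continuous function. *)
Lemma fiberwise_small_open : sl_open d fiberwise_small.
Proof.
move=> g gS.
pose V k := [set y | exists2 W, small_cover j n W & forall x, A x -> f x = y ->
  forall q, d (g x) q <= 2^-1 ^+ k -> W q]^°.
have [||a [ca a0 aV]] := @positive_minorant R Y V pY.
- by move=> k; exact: open_interior.
- rewrite -subTset => y _.
  have [W [oW KW sW]] := small_cover_open (gS y).
  have [k kH] := compact_margin (@cts_fun _ _ g) (@fA_compact y) oW KW.
  have [U [oU Uy US]] := fiber_tube fA_closed (@open_interior _ _) kH.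
  exists k => //; apply: filterS (open_nbhs_nbhs (conj oU Uy)) => y' Uy'.
  exists W => // x Ax fxy'; apply: (interior_subset (US x _)).
  by split => //=; rewrite fxy'.
exists (a \o f); split.
- by move=> x; apply: continuous_comp; [exact: cf|exact: ca].
- by move=> x; exact: a0.
- move=> h gh y; have [k Vy ak] := aV y.
  have [W sW WH] := interior_subset Vy.
  apply: small_cover_sub sW => _ [x [Ax fxy] <-].
  apply: (WH x Ax fxy); apply: le_trans (gh x) _ => /=.
  by rewrite fxy.
Qed.

End Openness.

(** * The Baire property of the source limitation topology *)

Section Baire.
Context {R : realType} {m : option nat} {X : topologicalType}.
Local Notation Q := (cube R m).
Variable d : Q -> Q -> R.
Hypothesis hd : compatible_metric d.
Local Notation C := (continuousType X Q).

Definition radius (a : X -> R) := continuous a /\ forall x, 0 < a x.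

Lemma sl_ball_refl (g : C) a : radius a -> sl_ball d g a g.
Proof. by move=> [_ a0] x; rewrite cmetric_xx// ltW. Qed.

Lemma radius_half (a : X -> R) : radius a -> radius (fun x => a x / 2).
Proof.
move=> [ca a0]; split => [x|x]; last by rewrite divr_gt0.
by apply: cvgMl; exact: ca.
Qed.

Lemma radius_min (a b : X -> R) : radius a -> radius b ->
  radius (fun x => Num.min (a x) (b x)).
Proof.
move=> [ca a0] [cb b0]; split => [x|x]; last by rewrite lt_min a0 b0.
by apply: continuous_min; [exact: ca|exact: cb].
Qed.

(** Nested closed balls with radii halved at each step.  A cluster point of the
    centres at each [x], given by compactness of the cube, defines a uniform
    limit locally, as the radii are dominated by [a0 x / 2^k]. *)
Lemma source_limitation_baire (F : nat -> set C) (g0 : C) (a0 : X -> R) :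
  (forall k, sl_open d (F k)) ->
  (forall k g a, radius a -> exists2 h, F k h & sl_ball d g a h) ->
  radius a0 -> exists2 g, (\bigcap_k F k) g & sl_ball d g0 a0 g.
Proof.
move=> oF dF gau0.
have stepP (kga : nat * (C * (X -> R))) : exists hb : C * (X -> R), radius kga.2.2 ->
    [/\ radius hb.2, sl_ball d hb.1 hb.2 `<=` F kga.1,
      sl_ball d hb.1 hb.2 `<=` sl_ball d kga.2.1 kga.2.2 &
      forall x, hb.2 x <= kga.2.2 x / 2].
  case: kga => k [g a] /=; have [ga|nga] := pselect (radius a); last by exists (g, a).
  have ga2 := radius_half ga.
  have [h Fh gh] := dF k g _ ga2.
  have [b [cb b0 bF]] := oF k h Fh.
  have gb : radius b by [].
  exists (h, fun x => Num.min (a x / 2) (b x)) => _ /=; split.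
  - exact: radius_min.
  - move=> h' hh'; apply: bF => x; apply: le_trans (hh' x) _.
    by rewrite ge_min lexx orbT.
  - move=> h' hh' x; have := cmetric_triangle hd (g x) (h x) (h' x).
    have := gh x; have : d (h x) (h' x) <= a x / 2.
      by apply: le_trans (hh' x) _; rewrite ge_min lexx.
    lra.
  - by move=> x; rewrite ge_min lexx.
have [step stepH] := choice stepP.
(* Centres and radii of the nested balls. *)
pose s := fix s k : C * (X -> R) := if k is k'.+1 then step (k', s k') else (g0, a0).
have gs k : radius (s k).2 by elim: k => [//|k IH]; have [] := stepH (k, s k) IH.
have sF k : sl_ball d (s k.+1).1 (s k.+1).2 `<=` F k.
  by have [_ + _ _] := stepH (k, s k) (gs k).
have ss k : sl_ball d (s k.+1).1 (s k.+1).2 `<=` sl_ball d (s k).1 (s k).2.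
  by have [_ _ + _] := stepH (k, s k) (gs k).
have s2 k x : (s k.+1).2 x <= (s k).2 x / 2.
  by have [_ _ _ +] := stepH (k, s k) (gs k); exact.
have smono k l : (k <= l)%N ->
    sl_ball d (s l).1 (s l).2 `<=` sl_ball d (s k).1 (s k).2.
  move=> /subnK <-; elim: (l - k)%N => [//|i IH].
  by rewrite addSn; exact: subset_trans (ss _) IH.
have sd k l x : (k <= l)%N -> d ((s k).1 x) ((s l).1 x) <= (s k).2 x.
  by move=> kl; apply: (smono k l kl); exact: sl_ball_refl.
have sexp k x : (s k).2 x <= a0 x * 2^-1 ^+ k.
  elim: k => [|k IH]; first by rewrite expr0 mulr1.
  by apply: le_trans (s2 k x) _; rewrite exprSr mulrA ler_pM2r// invr_gt0.
have gP x : exists q, forall k, d ((s k).1 x) q <= (s k).2 x.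
  pose G : set_system Q := (fun l => (s l).1 x) @ \oo.
  have [|q [_ clq]] := @cube_compact R m G _; first exact: filterT.
  exists q => k; apply/ler_addgt0Pr => e e0.
  have Gk : G [set q' | exists2 l, (k <= l)%N & q' = (s l).1 x].
    by exists k => // l /= kl; exists l.
  have [q' [[l kl ->] ql]] := clq _ _ Gk (cmetric_near hd q e0).
  have := cmetric_triangle hd ((s k).1 x) ((s l).1 x) q.
  rewrite (cmetric_sym hd ((s l).1 x)); have := sd k l x kl; move: ql => /=; lra.
have [g gH] := choice gP.
have cg : continuous g.
  move=> x B nB; have [e e0 eB] := proj1 (cmetric_nbhs hd (g x) B) nB.
  have a0x : 0 < a0 x by have [_ +] := gau0; exact.
  have [k _ /(_ k (leqnn k)) kH] := exp2V_lt (divr_gt0 (divr_gt0 e0 (ltr0n _ 4)) a0x).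
  have sk4 : (s k).2 x < e / 4.
    apply: le_lt_trans (sexp k x) _.
    by rewrite mulrC -ltr_pdivlMr.
  have [cs _] := gs k.
  have n1 : nbhs x [set x' | (s k).2 x' < e / 4].
    apply: open_nbhs_nbhs; split => //; apply: open_lt_fun => //.
    exact: cst_continuous.
  have e4 : 0 < e / 4 by rewrite divr_gt0.
  have n2 : nbhs x [set x' | d ((s k).1 x) ((s k).1 x') < e / 4].
    exact: (@cts_fun _ _ (s k).1 x _ (cmetric_near hd _ e4)).
  apply: filterS (filterI n1 n2) => x' /= [h1 h2]; apply: eB => /=.
  have h3 := gH x k; have h4 := gH x' k.
  have t1 := cmetric_triangle hd (g x) ((s k).1 x) (g x').
  have t2 := cmetric_triangle hd ((s k).1 x) ((s k).1 x') (g x').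
  have := cmetric_sym hd (g x) ((s k).1 x); lra.
exists (mkcts cg : C) => [k _|x]; first by apply: sF => x; exact: gH.
exact: (gH x 0%N).
Qed.

End Baire.

(** * Perfect restrictions and the dimension of unions of small compacta *)

Lemma cmetric_hausdorff (R : realType) (T : topologicalType) (d : T -> T -> R) :
  compatible_metric d -> hausdorff_space T.
Proof.
move=> hd p q clpq; apply/(cmetric_eq0 hd); apply/eqP.
rewrite eq_le (cmetric_ge0 hd) andbT; apply/ler_addgt0Pr => e e0.
have e2 : 0 < e / 2 by rewrite divr_gt0.
have [z [/= pz qz]] := clpq _ _ (cmetric_near hd p e2) (cmetric_near hd q e2).
have := cmetric_triangle hd p z q; rewrite (cmetric_sym hd z); lra.
Qed.

Lemma cmetric_set_type (R : realType) (T : topologicalType) (d : T -> T -> R)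
    (Z : set T) : compatible_metric d ->
  compatible_metric (fun a b : Z => d (\val a) (\val b)).
Proof.
move=> hd; split.
- by move=> *; exact: cmetric_ge0 hd _ _.
- by move=> a b; rewrite (cmetric_eq0 hd); split => [/val_inj|->].
- by move=> *; exact: cmetric_sym hd _ _.
- by move=> *; exact: cmetric_triangle hd _ _ _.
- move=> a S; split.
    move=> /set_type_nbhs[V [oV Va VS]].
    have [e e0 eV] := proj1 (cmetric_nbhs hd _ _) (open_nbhs_nbhs (conj oV Va)).
    by exists e => // b /= ab; apply/VS/eV.
  move=> [e e0 eS].
  have na : nbhs a (\val @^-1` [set y | d (\val a) y < e]).
    exact: (@set_val_continuous _ Z a _ (cmetric_near hd (\val a) e0)).
  by apply: filterS na => b /= ab; exact: eS.
Qed.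

Lemma closed_set_type (T : topologicalType) (A : set T) (C : set A) : closed C ->
  exists2 D, closed D & C = \val @^-1` D.
Proof.
move=> /closed_openC[E oE EC]; exists (~` E); first exact: open_closedC.
apply/seteqP; split => [a Ca Ea|a nEa].
  by have : (~` C) a by rewrite -EC.
by apply: contrapT => nCa; apply: nEa; rewrite -[E _]/((sval @^-1` E) a) EC.
Qed.

Section PerfectRestriction.
Context {X Y : topologicalType} (f : X -> Y) (A : set X).
Let F := sigLR [fun f in A].
Hypothesis pF : perfect_map F.

Lemma sigLR_val (a : A) : \val (F a) = f (\val a).
Proof. by []. Qed.

(** Closed sets of the subspace [f @` A] are closed in [Y] because [f @` A]
    is. *)
Lemma perfect_closed_image : closed (f @` A) ->
  forall C, closed C -> closed (f @` (A `&` C)).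
Proof.
move=> cfA C cC; have [_ clF _] := pF.
have cC' : closed ((\val : A -> X) @^-1` C).
  by apply: preimage_closed => // a _; exact: set_val_continuous.
have [D cD FD] := closed_set_type (clF _ cC').
rewrite (_ : f @` _ = f @` A `&` D); first exact: closedI.
apply/seteqP; split.
- move=> _ [x [Ax Cx] <-]; split; first by exists x.
  pose a : A := exist _ x (mem_set Ax).
  have : (F @` ((\val : A -> X) @^-1` C)) (F a) by exists a.
  by rewrite FD.
- move=> _ [[x Ax <-] Dx]; pose a : A := exist _ x (mem_set Ax).
  have : (\val @^-1` D) (F a) by [].
  rewrite -FD => -[b Cb bE]; exists (\val b); first by split => //; exact: set_valP.
  by rewrite -sigLR_val bE.
Qed.

Lemma perfect_compact_fiber y : compact (A `&` f @^-1` [set y]).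
Proof.
have [_ _ cF] := pF.
have [[x Ax fxy]|ny] := pselect ((f @` A) y); last first.
  rewrite (_ : _ `&` _ = set0); first exact: compact0.
  by rewrite -subset0 => x [Ax fxy]; apply: ny; exists x.
pose a : A := exist _ x (mem_set Ax).
rewrite (_ : _ `&` _ = (\val : A -> X) @` (F @^-1` [set F a])).
  apply: continuous_compact; last exact: cF.
  by apply: continuous_subspaceT; exact: set_val_continuous.
apply/seteqP; split.
- move=> z [Az fzy]; pose b : A := exist _ z (mem_set Az).
  exists b => //; apply: val_inj; rewrite !sigLR_val /=.
  by rewrite fxy.
- move=> _ [b Fb <-]; split; first exact: set_valP.
  by rewrite /= -sigLR_val Fb sigLR_val.
Qed.

End PerfectRestriction.

Section SmallCoversDim.
Context {R : realType} {m : option nat}.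
Local Notation Q := (cube R m).
Variables (d : Q -> Q -> R) (n : nat).
Hypothesis hd : compatible_metric d.

(** Choose [j] so large that boxes of size [j] around points of [C] are contained
    in members of the cover.  Grouping the sets of a small cover by such a member
    gives order at most [n], because the sets around a point have different
    colours. *)
Lemma small_cover_rel_dim (Z C : set Q) : C `<=` Z -> compact C ->
  (forall j, small_cover j n C) -> rel_dim_le n ((\val : Z -> Q) @^-1` C).
Proof.
move=> CZ cC sC k U oU CU.
have EP i : exists E : set Q, open E /\ (\val : Z -> Q) @^-1` E = U i.
  by have [E oE EU] := oU i; exists E.
have [E EH] := choice EP.
have CE : C `<=` \bigcup_i E i.
  move=> q Cq; pose z : Z := exist _ q (mem_set (CZ q Cq)).
  have [i _] := CU z Cq; have [_ <-] := EH i => Ez.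
  by exists i.
have oE i : open (E i) by have [] := EH i.
have [j jE] := box_lebesgue cC oE CE.
have [B [oB tB sB CB]] := sC j.
have idxP (D : set Q) : exists i : option 'I_k, forall a, B a D -> D `&` C !=set0 ->
    exists2 i', i = Some i' & D `<=` E i'.
  have [[a [BD [q [Dq Cq]]]]|nD] := pselect (exists a, B a D /\ D `&` C !=set0).
    have [i iE] := jE q Cq; exists (Some i) => _ _ _; exists i => // q' Dq'.
    by apply: iE; exact: sB BD Dq Dq'.
  by exists None => a BD DC; exfalso; apply: nD; exists a.
have [idx idxH] := choice idxP.
pose P i a D := [/\ B a D, D `&` C !=set0 & idx D = Some i].
exists (fun i => \bigcup_a \bigcup_(D in P i a) ((\val : Z -> Q) @^-1` D)); split.
- move=> i; apply: bigcup_open => a _; apply: bigcup_open => D [BD _ _].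
  by exists D => //; exact: oB BD.
- move=> i z [a _ [D [BD DC Di] Dz]].
  have [i' ii' DE] := idxH D a BD DC; move: ii'; rewrite Di => -[->].
  by have [_ <-] := EH i'; exact: DE.
- move=> z Cz; have [a _ [D BD Dz]] := CB _ Cz.
  have DC : D `&` C !=set0 by exists (\val z).
  have [i iD _] := idxH D a BD DC.
  by exists i => //; exists a => //; exists D.
- move=> z Cz; set S := [pred i | _].
  have colP i : exists a, i \in S -> exists2 D, P i a D & D (\val z).
    have [Si|nS] := boolP (i \in S); last by exists ord0.
    by move: Si; rewrite inE => /asboolP[a _ [D PD Dz]]; exists a => _; exists D.
  have [col colH] := choice colP.
  rewrite -(@card_in_imset _ _ col).
    by apply: leq_trans (max_card _) _; rewrite card_ord.
  move=> i i' Si Si' cc.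
  have [D [BD _ Di] Dz] := colH i Si; have [D' [BD' _ Di'] Dz'] := colH i' Si'.
  rewrite cc in BD; have DD := tB _ _ _ _ BD BD' Dz Dz'.
  by move: Di; rewrite DD Di' => -[].
Qed.

Lemma small_cover_sigma_dim (C : nat -> set Q) : (forall i, compact (C i)) ->
  (forall i j, small_cover j n (C i)) -> dim_le (\bigcup_i C i) n.
Proof.
move=> cC sC; apply: (metric_countable_sum
  (C := fun i => (\val : (\bigcup_i C i) -> Q) @^-1` C i)
  (cmetric_set_type _ hd)).
- move=> i; apply: preimage_closed; first by move=> a _; exact: set_val_continuous.
  by apply: compact_closed => //; exact: cmetric_hausdorff hd.
- by rewrite -subTset => z _; have [i _ Cz] := set_valP z; exists i.
- by move=> i; apply: small_cover_rel_dim => //; exact: bigcup_sup.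
Qed.

End SmallCoversDim.

(** * Generic maps and the dimension of fibre images *)

Local Close Scope ring_scope.

Theorem corollary1p2 (R : realType) (n : nat) (X Y : topologicalType)
    (f : X -> Y) (m : option nat) (d : cube R m -> cube R m -> R)
    (hX : paracompact X) (hY : paracompact Y) (hYC : C_space Y)
    (fcont : continuous f) (fsurj : range f = [set: Y])
    (fperf : sigma_perfect f) (fdim : dim_map_le f n)
    (hm : leq_omega n.+1 m) (hd : compatible_metric d) :
  exists H : set (source_limitation X d),
    [/\ Gdelta H, dense H
      & forall g : continuousType X (cube R m), H g ->
          forall y : Y, dim_le (g @` (f @^-1` [set y])) n].
Proof.
have [A [cvA pA]] := fperf.
have clA i : closed (A i) by have [] := pA i.
have fA_closed i C : closed C -> closed (f @` (A i `&` C)).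
  by have [_ pF cfA] := pA i; exact: perfect_closed_image.
have fA_compact i y : compact (A i `&` f @^-1` [set y]).
  by have [_ pF _] := pA i; exact: perfect_compact_fiber.
pose F i j := @fiberwise_small R m X Y n j f (A i).
pose E k := if (choice.unpickle k : option (nat * nat)) is Some ij
  then F ij.1 ij.2 else setT.
have oE k : sl_open d (E k).
  rewrite /E; case: choice.unpickle => [[i j]|]; last exact: sl_openT.
  exact: (@fiberwise_small_open R m X Y d n j f (A i) hd hY fcont
    (fA_closed i) (fA_compact i)).
have dE k g a : radius a -> exists2 h, E k h & sl_ball d g a h.
  move=> ga; rewrite /E; case: choice.unpickle => [[i j]|]; last first.
    by exists g => //; exact: sl_ball_refl.
  have [ca a0] := ga.
  have [h [ch gh hS]] := @fiberwise_small_approx R m X Y d n f (A i) g a hd hX hY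
    hYC fcont (clA i) (fA_closed i) (fA_compact i) fdim (@cts_fun _ _ g) ca a0 j.
  by exists (mkcts ch : continuousType X (cube R m)).
exists (\bigcap_k E k); split.
- by exists E.
- move=> O [g Og] oO; have [a [ca a0 aO]] := oO g Og.
  have [h hE gh] := source_limitation_baire hd g oE dE (conj ca a0 : radius a).
  by exists h; split => //; exact: aO.
- move=> g gE y.
  have -> : g @` (f @^-1` [set y]) =
      \bigcup_i g @` (A i `&` f @^-1` [set y]).
    by rewrite -image_bigcup -setI_bigcupl cvA setTI.
  apply: (small_cover_sigma_dim hd).
  + move=> i; apply: continuous_compact => //.
    by apply: continuous_subspaceT; exact: cts_fun.
  + move=> i j; have := gE (choice.pickle (i, j)) I.
    by rewrite /E choice.pickleK; exact.
Qed.
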